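(* Let $G$ be a direct sum of a countable family $\{G_i:i\in I\}$ of finitely generated abelian groups (not necessarily distinct). Then there exists a pure Krull domain $R$ with $\mathbb{Z}[X]\subseteq R\subseteq\mathbb{Q}[X]$ such that $\mathrm{Cl}(R)\cong G$. Moreover, for each $i\in I$ there is a multiplicative subset $S_i$ of $\mathbb{Z}$ such that $R_{S_i}$ is a pure Krull domain with $\mathrm{Cl}(R_{S_i})\cong G_i$.
   Context: A polynomial Krull domain is a Krull domain $R$ with $\mathbb{Z}[X]\subseteq R\subseteq\mathbb{Q}[X]$. It is pure if no height-one prime ideal $Q$ of $R$ with $Q\cap\mathbb{Z}\neq(0)$ is a maximal ideal of $R$. $\mathrm{Cl}(R)$ denotes the divisor class group of the Krull domain $R$, and $R_{S}$ the localization $S^{-1}R$. *)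

(* Defs.v *)
(* Rings between Z[X] and Q[X] are predicates on {poly rat};
   their common fraction field is Q(X) = {fraction {poly rat}}. *)
From HB Require Import structures.
From mathcomp Require Import all_boot all_order all_algebra fraction.
Set Implicit Arguments. Unset Strict Implicit. Unset Printing Implicit Defensive.
Import Order.TTheory GRing.Theory Num.Theory.
Local Open Scope ring_scope.

Notation QX := {fraction {poly rat}}.

Definition int_poly (p : {poly rat}) : Prop := forall i, p`_i \is a Num.int.

Definition subring (R : {poly rat} -> Prop) : Prop :=
  R 1 /\ (forall p q, R p -> R q -> R (p - q)) /\
  (forall p q, R p -> R q -> R (p * q)).

(** Z[X] ⊆ R ⊆ Q[X] (the second inclusion is by typing). *)
Definition poly_ring_between (R : {poly rat} -> Prop) : Prop :=
  subring R /\ (forall p, int_poly p -> R p).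

Definition ideal (R I : {poly rat} -> Prop) : Prop :=
  (forall p, I p -> R p) /\ I 0 /\ (forall p q, I p -> I q -> I (p + q)) /\
  (forall r p, R r -> I p -> I (r * p)).

Definition prime_ideal (R Q : {poly rat} -> Prop) : Prop :=
  ideal R Q /\ ~ Q 1 /\ (forall a b, R a -> R b -> Q (a * b) -> Q a \/ Q b).

Definition maximal_ideal (R M : {poly rat} -> Prop) : Prop :=
  ideal R M /\ ~ M 1 /\
  (forall J, ideal R J -> (forall p, M p -> J p) -> J 1 \/ (forall p, J p -> M p)).

Definition height_one_prime (R Q : {poly rat} -> Prop) : Prop :=
  prime_ideal R Q /\ (exists q, Q q /\ q != 0) /\
  (forall P, prime_ideal R P -> (forall p, P p -> Q p) ->
     (forall p, P p -> p = 0) \/ (forall p, Q p -> P p)).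

Definition pure (R : {poly rat} -> Prop) : Prop :=
  forall Q, height_one_prime R Q ->
    (exists n : int, n != 0 /\ Q (n%:~R)) -> ~ maximal_ideal R Q.

Definition inK (R : {poly rat} -> Prop) (x : QX) : Prop :=
  exists p, R p /\ x = FracField.tofrac p.

(** A (normalized) discrete valuation of Q(X); its values on 0 are irrelevant. *)
Definition discrete_valuation (v : QX -> int) : Prop :=
  (forall x y, x != 0 -> y != 0 -> v (x * y) = v x + v y) /\
  (forall x y, x != 0 -> y != 0 -> x + y != 0 -> Num.min (v x) (v y) <= v (x + y)) /\
  (exists x, x != 0 /\ v x = 1).

Definition krull (R : {poly rat} -> Prop) : Prop :=
  subring R /\ exists V : (QX -> int) -> Prop,
    (forall v, V v -> discrete_valuation v) /\
    (forall x, x != 0 -> (inK R x <-> forall v, V v -> 0 <= v x)) /\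
    (forall x, x != 0 -> exists (n : nat) (f : nat -> QX -> int),
        forall v, V v -> v x != 0 -> exists i, (i < n)%N /\ v = f i).

Definition frac_ideal (R : {poly rat} -> Prop) (A : QX -> Prop) : Prop :=
  A 0 /\ (forall x y, A x -> A y -> A (x + y)) /\
  (forall r x, inK R r -> A x -> A (r * x)) /\
  (exists x, A x /\ x != 0) /\
  (exists d, d != 0 /\ inK R d /\ forall x, A x -> inK R (d * x)).

Definition colon (R : {poly rat} -> Prop) (A : QX -> Prop) : QX -> Prop :=
  fun x => forall a, A a -> inK R (x * a).

Definition divisorial (R : {poly rat} -> Prop) (A : QX -> Prop) : Prop :=
  frac_ideal R A /\ (forall x, A x <-> colon R (colon R A) x).

(** (AB)_v = (R : (R : AB)), with (R : AB) = {y | y a b ∈ R for a ∈ A, b ∈ B}. *)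
Definition vmul (R : {poly rat} -> Prop) (A B : QX -> Prop) : QX -> Prop :=
  colon R (fun y => forall a b, A a -> B b -> inK R (y * a * b)).

Definition principal (R : {poly rat} -> Prop) (A : QX -> Prop) : Prop :=
  exists x, x != 0 /\ forall y, A y <-> exists r, inK R r /\ y = x * r.

(** Cl(R) ≅ (H, add, zero) restricted to the subset Hin of H: a homomorphism
    from the group of divisorial fractional ideals (under v-multiplication)
    onto Hin whose kernel is exactly the principal fractional ideals. *)
Definition cl_iso (R : {poly rat} -> Prop) (H : Type) (Hin : H -> Prop)
    (add : H -> H -> H) (zero : H) : Prop :=
  exists phi : (QX -> Prop) -> H,
    (forall A B, divisorial R A -> divisorial R B ->
       (forall x, A x <-> B x) -> phi A = phi B) /\
    (forall A, divisorial R A -> Hin (phi A)) /\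
    (forall h, Hin h -> exists A, divisorial R A /\ phi A = h) /\
    (forall A B, divisorial R A -> divisorial R B ->
       phi (vmul R A B) = add (phi A) (phi B)) /\
    (forall A, divisorial R A -> (phi A = zero <-> principal R A)).

Definition fin_gen (M : zmodType) : Prop :=
  exists s : seq M, forall g : M,
    exists c : seq int, g = \sum_(k < size s) s`_k *~ c`_k.

Definition dsum_in (I : eqType) (G : I -> zmodType) (h : forall i, G i) : Prop :=
  exists s : seq I, forall i, i \notin s -> h i = 0.
Definition dsum_add (I : Type) (G : I -> zmodType) (h k : forall i, G i) :
  forall i, G i := fun i => h i + k i.
Definition dsum_zero (I : Type) (G : I -> zmodType) : forall i, G i := fun i => 0.

Definition mult_subset (S : int -> Prop) : Prop :=
  S 1 /\ ~ S 0 /\ (forall a b, S a -> S b -> S (a * b)).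

Definition localize (R : {poly rat} -> Prop) (S : int -> Prop) : {poly rat} -> Prop :=
  fun p => exists s, S s /\ R (s%:~R * p).

(* Main.v *)
(** A prime [p] of [Z] together with integers [c] and [e > 0] gives a valuation of
    [Q(X)]: the monomial valuation with [v(p) = e] and [v(X - c) = 1], whose residue
    field is transcendental over [F_p].  Intersect [Q[X]] with countably many of
    them, at most two over each prime, with centers distinct modulo [p]; choosing
    the primes sparsely makes every nonzero polynomial a unit at almost all of them,
    so the intersection [R] is a Krull domain.  As [Q[X]] has trivial class group,
    [Cl(R)] is generated by the places over the integer primes, the relations being
    the divisors of the primes [p]: a prime carrying one place contributes [Z/e],
    and a prime carrying two places with [e = 1] contributes [Z].  A finitely
    generated group is a sum of cyclic ones, each realized at its own prime, and
    inverting the primes used for the other groups isolates one [G i].  Purity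
    holds since a height-one prime meeting [Z] is the center of some place, where
    [(X - c)^e / p], up to a unit, has a transcendental residue. *)

Require Import Defs.
From HB Require Import structures.
From mathcomp Require Import all_boot all_order all_algebra fraction.
From mathcomp Require Import boolp zify ring.
Import Order.TTheory GRing.Theory Num.Theory.
Local Open Scope ring_scope.

Set Implicit Arguments. Unset Strict Implicit. Unset Printing Implicit Defensive.

(** The divisor theory of a Krull domain is not assumed but rebuilt from one approximation property:
    a finitely supported divisor can be attained exactly at one index and bounded from below at all
    others. This is why the centers over one prime must differ modulo p. A constant moves both
    places over p by the same amount, whereas [X - c] has value 1 at its own place and 0 at the
    other, so the two values can be steered independently.

    Principal divisors are controlled in two stages. The part of a divisor at the irreducible
    polynomials is always that of some f in Q(X), unique up to a rational constant. What remains at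
    the places is therefore defined up to divisors of constants, and these give exactly the
    relations of the cyclic summands. Over a prime with two places of ramification 1 the sum of the
    places is principal, so they represent opposite generators.

    All rings needed belong to one family, indexed by the set [U] of primes kept; localization only
    shrinks [U], so every property is proved once. *)

Section Valuation.
Variable D : idomainType.
Implicit Types (v : D -> int) (x y : D).

(** A common lower bound [m] replaces the minimum, which keeps later arguments in linear arithmetic.
    The value at 0 is unconstrained. *)
Definition valuation v : Prop :=
  (forall x y, x != 0 -> y != 0 -> v (x * y) = v x + v y) /\
  (forall m x y, x != 0 -> y != 0 -> x + y != 0 ->
     m <= v x -> m <= v y -> m <= v (x + y)).

Variable v : D -> int.
Hypothesis vv : valuation v.

Lemma valuM x y : x != 0 -> y != 0 -> v (x * y) = v x + v y.
Proof. by case: vv => + _; apply. Qed.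

Lemma valuD m x y : x != 0 -> y != 0 -> x + y != 0 ->
  m <= v x -> m <= v y -> m <= v (x + y).
Proof. by case: vv => _; apply. Qed.

Lemma valu1 : v 1 = 0.
Proof. by have := valuM (oner_neq0 D) (oner_neq0 D); rewrite mulr1; move: (v 1) => a; lia. Qed.

Lemma valuN1 : v (-1) = 0.
Proof.
have n1 : (-1 : D) != 0 by rewrite oppr_eq0 oner_neq0.
by have := valuM n1 n1; rewrite mulrNN mulr1 valu1; move: (v _) => a; lia.
Qed.

Lemma valuN x : x != 0 -> v (- x) = v x.
Proof.
move=> x0; have n1 : (-1 : D) != 0 by rewrite oppr_eq0 oner_neq0.
by rewrite -mulN1r valuM // valuN1 add0r.
Qed.

Lemma valuX x n : x != 0 -> v (x ^+ n) = v x * n%:Z.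
Proof.
move=> x0; elim: n => [|n IH]; first by rewrite expr0 valu1 mulr0.
by rewrite exprS valuM ?expf_neq0 // IH -[n.+1]add1n PoszD mulrDr mulr1.
Qed.

Lemma valu_prod (T : eqType) (s : seq T) (P : pred T) (F : T -> D) :
  (forall i, i \in s -> P i -> F i != 0) ->
  \prod_(i <- s | P i) F i != 0 /\
  v (\prod_(i <- s | P i) F i) = \sum_(i <- s | P i) v (F i).
Proof.
elim: s => [|a s IH] Fn0; first by rewrite !big_nil valu1 oner_neq0.
have [] := IH _ => [i si|n0 vE]; first by apply: Fn0; rewrite inE si orbT.
rewrite !big_cons; case: ifP => // Pa.
have a0 : F a != 0 by apply: Fn0 => //; rewrite mem_head.
by rewrite mulf_neq0 // valuM // vE.
Qed.

End Valuation.

Section FieldValuation.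
Variables (K : fieldType) (v : K -> int).
Hypothesis vv : valuation v.

Lemma valuV (x : K) : x != 0 -> v x^-1 = - v x.
Proof.
move=> x0; have := valuM vv x0 (invr_neq0 x0).
by rewrite divff // valu1 //; lia.
Qed.

Lemma valu_div (x y : K) : x != 0 -> y != 0 -> v (x / y) = v x - v y.
Proof. by move=> x0 y0; rewrite (valuM vv) ?invr_eq0 // valuV. Qed.

Lemma valuXz (x : K) (n : int) : x != 0 -> v (x ^ n) = v x * n.
Proof.
move=> x0; case: n => n; first exact: (valuX vv).
by rewrite NegzE -exprnN valuV ?expf_neq0 // (valuX vv) // mulrN.
Qed.
End FieldValuation.

(** * Extending a valuation from Q[X] to Q(X) *)

Local Notation "x %:F" := (FracField.tofrac x).

Lemma fracP (x : QX) : exists fg : {poly rat} * {poly rat},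
  fg.2 != 0 /\ x = fg.1%:F / fg.2%:F.
Proof.
elim/quotW: x => r; exists (r.1, r.2) => /=.
have d0 := denom_ratioP r; split => //.
apply: (canRL (mulfK _)); first by rewrite tofrac_eq0.
rewrite !piE /=; apply/eqmodP.
rewrite /= FracField.equivfE /FracField.mulf /= !numden_Ratio ?mulr1 ?mul1r ?oner_neq0 //.
by rewrite mulrC.
Qed.

Definition frac_val (w : {poly rat} -> int) (x : QX) : int :=
  let fg := projT1 (cid (fracP x)) in w fg.1 - w fg.2.

Section FracVal.
Variable w : {poly rat} -> int.
Hypothesis vw : valuation w.

(** Independence of the representation picked by [frac_val]: cross-multiply and use additivity of
    [w]. *)
Lemma frac_valE f g : f != 0 -> g != 0 ->
  frac_val w (f%:F / g%:F) = w f - w g.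
Proof.
rewrite /frac_val; case: cid => -[a b] /= [b0 E] f0 g0.
have b0' : b%:F != 0 by rewrite tofrac_eq0.
have g0' : g%:F != 0 by rewrite tofrac_eq0.
move/eqP: E; rewrite (eqr_div _ _ g0' b0') -!tofracM tofrac_eq => /eqP E.
have a0 : a != 0.
  apply: contraNneq f0 => a0; move/eqP: E.
  by rewrite a0 mul0r mulf_eq0 (negbTE b0) orbF.
by have := congr1 w E; rewrite !(valuM vw) //; lia.
Qed.

Lemma frac_val_poly f : f != 0 -> frac_val w f%:F = w f.
Proof.
move=> f0; rewrite -[f%:F]divr1 -tofrac1 frac_valE ?oner_neq0 //.
by rewrite (valu1 vw) subr0.
Qed.

Lemma frac_neq0P (x : QX) : x != 0 ->
  exists f g, [/\ f != 0, g != 0 & x = f%:F / g%:F].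
Proof.
have [[f g] /= [g0 ->]] := fracP x => x0; exists f, g; split => //.
by apply: contraNneq x0 => ->; rewrite tofrac0 mul0r.
Qed.

Lemma frac_valuation : valuation (frac_val w).
Proof.
split=> [x y|m x y] /frac_neq0P [f [g [f0 g0 ->]]]
        /frac_neq0P [f' [g' [f'0 g'0 ->]]].
  by rewrite mulf_div -!tofracM !frac_valE ?mulf_neq0 // !(valuM vw) //; lia.
have gF : g%:F != 0 by rewrite tofrac_eq0.
have gF' : g'%:F != 0 by rewrite tofrac_eq0.
have -> : f%:F / g%:F + f'%:F / g'%:F = (f * g' + f' * g)%:F / (g * g')%:F.
  by rewrite tofracD !tofracM (addf_div _ _ gF gF').
move=> n0.
have s0 : f * g' + f' * g != 0.
  by apply: contraNneq n0 => ->; rewrite tofrac0 mul0r.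
rewrite !frac_valE ?mulf_neq0 // !(valuM vw) // => le1 le2.
rewrite lerBrDr; apply: (valuD vw); rewrite ?mulf_neq0 // (valuM vw) //; lia.
Qed.

End FracVal.

Lemma valuation_discrete (v : QX -> int) (x : QX) :
  valuation v -> x != 0 -> v x = 1 -> discrete_valuation v.
Proof.
move=> vv x0 vx; split; [|split]; last by exists x.
- by move=> a b a0 b0; apply: (valuM vv a0 b0).
- by move=> a b a0 b0 ab0; apply: (valuD vv a0 b0 ab0); rewrite ge_min lexx ?orbT.
Qed.

(** * The p-adic valuation on the rationals *)

Definition vp (p : nat) (x : rat) : int :=
  (logn p `|numq x|%N)%:Z - (logn p `|denq x|%N)%:Z.

Section Padic.
Variable p : nat.
Hypothesis p_pr : prime p.

Definition vpz (a : int) : int := (logn p `|a|%N)%:Z.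

Lemma vpz_valuation : valuation vpz.
Proof.
split=> [a b a0 b0|m a b a0 b0 ab0].
  by rewrite /vpz abszM lognM ?absz_gt0.
(* A natural bound [m] means divisibility by [p ^ m], which is stable under sums; a negative bound
   is trivial. *)
rewrite /vpz; case: m => [m|m]; last by lia.
have dE c : c != 0 -> (m%:Z <= (logn p `|c|)%:Z) = ((p ^ m)%N%:Z %| c)%Z.
  by move=> c0; rewrite lez_nat -pfactor_dvdn ?absz_gt0 // dvdzE.
by rewrite !dE // => da db; rewrite rpredD.
Qed.

Lemma vpE (a b : int) : a != 0 -> b != 0 -> vp p (a%:~R / b%:~R) = vpz a - vpz b.
Proof.
move=> a0 b0; rewrite /vp; set x := a%:~R / b%:~R.
have x0 : x != 0 by rewrite mulf_neq0 ?invr_eq0 ?intr_eq0.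
have E : numq x * b = a * denq x.
  apply: (@intr_inj rat); rewrite !rmorphM /= numqE /x.
  by rewrite mulrAC divfK ?intr_eq0.
have := congr1 vpz E.
rewrite !(valuM vpz_valuation) ?denq_neq0 ?numq_eq0 // /vpz; lia.
Qed.

Lemma vp_valuation : valuation (vp p).
Proof.
have rE (x : rat) : x != 0 -> exists a b : int,
    [/\ a != 0, b != 0 & x = a%:~R / b%:~R].
  by move=> x0; exists (numq x), (denq x); rewrite numq_eq0 denq_neq0 divq_num_den.
split=> [x y|m x y] /rE [a [b [a0 b0 ->]]] /rE [c [d [c0 d0 ->]]].
  rewrite mulf_div -!rmorphM !vpE ?mulf_neq0 // !(valuM vpz_valuation) //; lia.
rewrite addf_div ?intr_eq0 // -!rmorphM -rmorphD => n0.
have s0 : a * d + c * b != 0.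
  by apply: contraNneq n0 => ->; rewrite mul0r.
rewrite !vpE ?mulf_neq0 // !(valuM vpz_valuation) // => le1 le2.
rewrite lerBrDr; apply: (valuD vpz_valuation); rewrite ?mulf_neq0 // (valuM vpz_valuation) //; lia.
Qed.

Lemma vp_int (a : int) : a != 0 -> vp p a%:~R = vpz a.
Proof. by move=> a0; rewrite -[a%:~R]divr1 (vpE a0 (oner_neq0 _)) /vpz logn1 subr0. Qed.

End Padic.

(** * Monomial valuations centered at 0, with p of value e and X of value 1 *)

Section Gauss.
Variables (p : nat) (e : nat).
Hypothesis p_pr : prime p.

(** The monomial [b X^n] has value at least [m]; a zero coefficient counts as having infinite
    value. *)
Definition tge (n : nat) (m : int) (b : rat) : Prop :=
  b != 0 -> m <= e%:Z * vp p b + n%:Z.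

Lemma tge0 n m : tge n m 0.
Proof. by rewrite /tge eqxx. Qed.

Lemma tgeD n m a b : tge n m a -> tge n m b -> tge n m (a + b).
Proof.
have [->|a0] := eqVneq a 0; first by rewrite add0r.
have [->|b0] := eqVneq b 0; first by rewrite addr0.
move=> /(_ a0) ha /(_ b0) hb n0.
have [h|h] := leP (vp p a) (vp p b).
- apply: le_trans ha _; rewrite lerD2r ler_wpM2l //.
  exact: (valuD (vp_valuation p_pr)).
- apply: le_trans hb _; rewrite lerD2r ler_wpM2l //.
  by apply: (valuD (vp_valuation p_pr)) => //; apply: ltW.
Qed.

Lemma tge_sum (T : Type) (s : seq T) (P : pred T) (F : T -> rat) n m :
  (forall i, P i -> tge n m (F i)) -> tge n m (\sum_(i <- s | P i) F i).
Proof.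
by move=> h; apply: big_ind h; [exact: tge0|move=> *; exact: tgeD].
Qed.

Lemma tgeM n m a n' m' b :
  tge n m a -> tge n' m' b -> tge (n + n') (m + m') (a * b).
Proof.
move=> ha hb; rewrite /tge mulf_eq0 negb_or => /andP [a0 b0].
rewrite (valuM (vp_valuation p_pr)) // mulrDr PoszD addrACA.
by rewrite lerD ?ha ?hb.
Qed.

Lemma tge_le n m m' b : m' <= m -> tge n m b -> tge n m' b.
Proof. by move=> h hb b0; apply: le_trans h (hb b0). Qed.

(* [m] is the least value of a term of [f], and [i] is the largest index at
   which it is reached: the degree of the residue of [f] when [m = 0]. *)
Definition min_term (f : {poly rat}) (m : int) (i : nat) : Prop :=
  [/\ f`_i != 0, e%:Z * vp p f`_i + i%:Z = m, forall j, tge j m f`_j &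
      forall j, (i < j)%N -> tge j (m + 1) f`_j].

Lemma min_term_uniq f m i m' i' :
  min_term f m i -> min_term f m' i' -> m = m' /\ i = i'.
Proof.
move=> [i0 im g1 g2] [i'0 i'm g1' g2'].
have := g1 i' i'0; have := g1' i i0; rewrite im i'm => h1 h2.
have mm : m = m' by lia.
split => //; have [lt|lt|//] := ltngtP i i'.
- by have := g2 _ lt i'0; rewrite i'm; lia.
- by have := g2' _ lt i0; rewrite im; lia.
Qed.

Let lex_aux (N A B : int) (i j : nat) :
  A - i%:Z <= B - j%:Z -> i%:Z < N -> B + N <= A -> False.
Proof. by lia. Qed.

Lemma min_term_exists f : f != 0 -> exists m i, min_term f m i.
Proof.
move=> f0.
have sf : (0 < size f)%N by rewrite size_poly_gt0.
have lc : f`_(size f).-1 != 0 by rewrite -lead_coefE lead_coef_eq0.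
have ls : ((size f).-1 < size f)%N by rewrite prednK.
pose N : int := (size f)%:Z.
pose t (i : nat) : int := e%:Z * vp p f`_i + i%:Z.
(* Since indices are below [N], minimizing [N * t i - i] is a lexicographic choice: least [t] first,
   then the largest index. *)
case: (@Order.TotalTheory.arg_minP _ _ _ (Ordinal ls) (fun i : 'I_(size f) => f`_i != 0)
   (fun i : 'I_(size f) => N * t i - i%:Z) lc) => i i0 imin.
have sz j : f`_j != 0 -> (j < size f)%N.
  by move=> j0; rewrite ltnNge; apply: contra j0 => /leq_sizeP ->.
have lex j : f`_j != 0 -> t i <= t j /\ ((i < j)%N -> t i < t j).
  move=> j0; have sj := sz j j0; have := imin (Ordinal sj) j0; rewrite /= => le.
  have tij : t i <= t j.
    rewrite leNgt; apply/negP; rewrite -lezD1 => lt.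
    have lt' := ler_wpM2l (isT : 0 <= N) lt; rewrite mulrDr mulr1 in lt'.
    have iN : (i : nat)%:Z < N := ltn_ord i;
    exact: lex_aux le iN lt'.
  split=> // ij; rewrite lt_neqAle tij andbT; apply: contraTneq le => ->.
  by move: (N * t j); clear -ij; lia.
exists (t i), i; split=> // j; last move=> ij; move=> j0; have [h1 h2] := lex j j0.
  exact: h1.
by rewrite lezD1; exact: h2.
Qed.

(** Gauss's lemma: any other pair of indices with sum [i + j] exceeds [i] or [j] in one component,
    so its product has a larger value and cannot cancel the product of the two minimal terms. *)
Lemma min_termM f m i g n j : min_term f m i -> min_term g n j ->
  min_term (f * g) (m + n) (i + j).
Proof.
move=> [i0 im f1 f2] [j0 jn g1 g2].
have ti : (i < (i + j).+1)%N by rewrite ltnS leq_addr.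
have tgt k l : ((i < k) || (j < l))%N -> tge (k + l) (m + n + 1) (f`_k * g`_l).
  case/orP=> h.
  - by rewrite addrAC; apply: tgeM; [exact: f2|exact: g1].
  - by rewrite -addrA; apply: tgeM; [exact: f1|exact: g2].
have tall k : tge k (m + n) (f * g)`_k.
  rewrite coefM; apply: tge_sum => l _.
  have {1}-> : (k = l + (k - l))%N by rewrite subnKC // -ltnS.
  by apply: tgeM.
have tlarge k : (i + j < k)%N -> tge k (m + n + 1) (f * g)`_k.
  move=> ijk; rewrite coefM; apply: tge_sum => l _.
  have lk : (l <= k)%N by rewrite -ltnS.
  have {1}-> : (k = l + (k - l))%N by rewrite subnKC.
  by apply: tgt; lia.
have [S0 E] : exists S, tge (i + j) (m + n + 1) S /\
    (f * g)`_(i + j) = f`_i * g`_j + S.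
  exists (\sum_(l < (i + j).+1 | l != Ordinal ti) f`_l * g`_(i + j - l)).
  split; last by rewrite coefM (bigD1 (Ordinal ti)) //= addKn.
  apply: tge_sum => l nl.
  have lk : (l <= i + j)%N by rewrite -ltnS.
  have {1}-> : (i + j = l + (i + j - l))%N by rewrite subnKC.
  apply: tgt; have : (l : nat) != i by [].
  by lia.
move: E => [tS E].
have a0 : f`_i * g`_j != 0 by rewrite mulf_neq0.
have va : e%:Z * vp p (f`_i * g`_j) + (i + j)%N%:Z = m + n.
  by rewrite (valuM (vp_valuation p_pr)) // -im -jn; lia.
have nz : (f * g)`_(i + j) != 0.
  rewrite E; apply: contraTneq a0 => z; apply/negP => a0.
  have eS : S0 = - (f`_i * g`_j) by apply/eqP; rewrite -addr_eq0 addrC z.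
  have := tS; rewrite eS => /(_ _); rewrite oppr_eq0 => /(_ a0).
  by rewrite (valuN (vp_valuation p_pr)) // va; lia.
split => //.
apply/eqP; rewrite eq_le (tall _ nz) andbT leNgt; apply/negP => lt.
have : tge (i + j) (m + n + 1) (f`_i * g`_j).
  have -> : f`_i * g`_j = (f * g)`_(i + j) + - S0 by rewrite E addrK.
  apply: tgeD; first by move=> _; rewrite lezD1.
  rewrite /tge oppr_eq0 => s0; rewrite (valuN (vp_valuation p_pr)) //.
  exact: tS.
by move/(_ a0); rewrite va; lia.
Qed.

Lemma min_termD f m i g n j h k l : min_term f m i -> min_term g n j ->
  min_term (f + g) k l -> h <= m -> h <= n -> h <= k.
Proof.
move=> [_ _ f1 _] [_ _ g1 _] [l0 <- _ _] hm hn.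
have : tge l h (f + g)`_l.
  by rewrite coefD; apply: tgeD; [apply: tge_le (f1 l)|apply: tge_le (g1 l)].
exact.
Qed.

End Gauss.

(** * Monomial valuations centered at an integer, and their residues *)

Section Center.
Variables (p e : nat) (c : int).
Hypothesis p_pr : prime p.

Definition shift (f : {poly rat}) : {poly rat} := f \Po ('X + c%:~R%:P).

Lemma shift_eq0 f : (shift f == 0) = (f == 0).
Proof. by rewrite -!size_poly_eq0 size_comp_poly2 // size_XaddC. Qed.

(** The default value 0 at the zero polynomial lets the condition [0 <= gauss f] include it. *)
Definition gauss (f : {poly rat}) : int :=
  if pselect (exists m i, min_term p e (shift f) m i) is left h
  then projT1 (cid h) else 0.

Lemma gaussP f m i : min_term p e (shift f) m i -> gauss f = m.
Proof.
rewrite /gauss; case: pselect => [h|n] mt; last by case: n; exists m, i.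
case: cid => m' /= [i' mt']; exact: (min_term_uniq p_pr mt' mt).1.
Qed.

Lemma gauss_exists f : f != 0 -> exists i, min_term p e (shift f) (gauss f) i.
Proof.
rewrite -shift_eq0 => /(min_term_exists e p_pr) [m [i mt]].
by exists i; rewrite (gaussP mt).
Qed.

Lemma gauss0 : gauss 0 = 0.
Proof.
rewrite /gauss; case: pselect => // h; exfalso; case: h => m [i [+ _ _ _]].
by rewrite /shift comp_poly0 coef0 eqxx.
Qed.

Lemma gauss_valuation : valuation gauss.
Proof.
split=> [f g f0 g0|m f g f0 g0 fg0].
  have [i hi] := gauss_exists f0; have [j hj] := gauss_exists g0.
  by apply: (@gaussP _ _ (i + j)); rewrite /shift comp_polyM; apply: min_termM.
have [i hi] := gauss_exists f0; have [j hj] := gauss_exists g0.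
have [k hk] := gauss_exists fg0.
by apply: (min_termD p_pr hi hj (k := gauss (f + g)) (l := k)); rewrite /shift -comp_polyD.
Qed.

Lemma min_term_C (a : rat) : a != 0 -> min_term p e a%:P (e%:Z * vp p a) 0.
Proof.
move=> a0; split; rewrite ?coefC ?addr0 //.
- by case=> [|j]; rewrite coefC /=; [move=> _; rewrite addr0|exact: tge0].
- by move=> [|j] //; rewrite coefC /= => _; exact: tge0.
Qed.

Lemma gaussC (a : rat) : a != 0 -> gauss a%:P = e%:Z * vp p a.
Proof. by move=> a0; apply: (@gaussP _ _ 0); rewrite /shift comp_polyC; apply: min_term_C. Qed.

Lemma gauss_int (a : int) : a != 0 -> gauss a%:~R = e%:Z * (logn p `|a|)%:Z.
Proof.
move=> a0; have -> : a%:~R = (a%:~R : rat)%:P by rewrite rmorph_int.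
by rewrite gaussC ?intr_eq0 // vp_int.
Qed.

Lemma min_term_X : min_term p e 'X 1 1.
Proof.
split; rewrite ?coefX //=.
- by rewrite (valu1 (vp_valuation p_pr)) mulr0.
- case=> [|[|j]]; rewrite coefX /= ?(valu1 (vp_valuation p_pr)); try exact: tge0.
  by move=> _; rewrite (valu1 (vp_valuation p_pr)) mulr0.
- by case=> [|[|j]] //; rewrite coefX /= => _; exact: tge0.
Qed.

Lemma min_term_center : min_term p e (shift ('X - c%:~R%:P)) 1 1.
Proof.
rewrite /shift comp_polyB comp_polyX comp_polyC addrK; exact: min_term_X.
Qed.

Lemma gauss_center : gauss ('X - c%:~R%:P) = 1.
Proof. exact: gaussP min_term_center. Qed.

(** After the shift the constant coefficient is [q.[c]], a p-adic unit, and no term of an integer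
    polynomial has negative value. *)
Lemma min_term_unit (q : {poly int}) : q.[c] != 0 -> logn p `|q.[c]| = 0%N ->
  gauss (map_poly intr q) = 0.
Proof.
move=> qc lq.
have E : shift (map_poly intr q) = map_poly intr (q \Po ('X + c%:P)).
  by rewrite /shift map_comp_poly rmorphD /= map_polyX map_polyC.
have C0 : (q \Po ('X + c%:P))`_0 = q.[c].
  by rewrite -horner_coef0 horner_comp !hornerE.
have [m [i mt]] : exists m i, min_term p e (shift (map_poly intr q)) m i.
  apply: (min_term_exists e p_pr); rewrite E; apply: contraNneq qc => z.
  have := congr1 (fun g : {poly rat} => g`_0) z; rewrite coef_map C0 coef0 /=.
  by move/eqP; rewrite intr_eq0.
rewrite (gaussP mt); move: mt; rewrite E => -[i0 im g1 _].
move: (g1 0%N); rewrite coef_map C0 /tge /= intr_eq0 => /(_ qc).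
rewrite vp_int // /vpz lq mulr0 addr0 => m0.
move: i0 im; rewrite coef_map /= intr_eq0 => i0.
rewrite vp_int // /vpz; nia.
Qed.

Lemma gauss_int_ge0 (q : {poly int}) : 0 <= gauss (map_poly intr q).
Proof.
have [->|q0] := eqVneq q 0; first by rewrite rmorph0 gauss0.
have E : shift (map_poly intr q) = map_poly intr (q \Po ('X + c%:P)).
  by rewrite /shift map_comp_poly rmorphD /= map_polyX map_polyC.
have [|i] := @gauss_exists (map_poly intr q).
  by rewrite map_poly_eq0_id0 ?intr_eq0 // lead_coef_eq0.
rewrite E => -[i0 <- _ _].
by move: i0; rewrite coef_map intr_eq0 => i0; rewrite vp_int // /vpz; lia.
Qed.

Lemma tge_gauss f m : (f != 0 -> m <= gauss f) ->
  forall j, tge p e j m (shift f)`_j.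
Proof.
have [->|f0] := eqVneq f 0.
  by move=> _ j; rewrite /shift comp_poly0 coef0; apply: tge0.
have [i [_ _ h _]] := gauss_exists f0 => /(_ isT) le j.
exact: tge_le le (h j).
Qed.

(* [i] is the degree of the residue of [f], and residue degrees are additive,
   so a positive one prevents [f] from being invertible modulo the center. *)
Lemma residue_not_unit f i r : min_term p e (shift f) 0 i -> (0 < i)%N ->
  (r != 0 -> 0 <= gauss r) -> ~ (1 - r * f != 0 -> 0 < gauss (1 - r * f)).
Proof.
move=> mf i0 hr h1.
have t1' : forall j, tge p e j 1 (shift (1 - r * f))`_j.
  by apply: tge_gauss => /h1; lia.
have sE : shift (1 - r * f) = 1 - shift (r * f).
  by rewrite /shift comp_polyB -polyC1 comp_polyC.
have v1 : vp p 1 = 0 := valu1 (vp_valuation p_pr).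
have n1 : ~ tge p e 0 1 1 by rewrite /tge oner_neq0 v1 mulr0 => /(_ isT).
have [r0|r0] := eqVneq r 0.
  by apply: n1; have := t1' 0%N; rewrite sE r0 mul0r /shift comp_poly0 subr0 coef1.
have [k mr] := gauss_exists r0.
have [n0 nE n_ge _] := min_termM p_pr mr mf.
rewrite addr0 -comp_polyM -/(shift _) in n0 nE n_ge.
(* The term of [r * f] at the positive index [k + i] attains the value of [r], and the constant 1
   does not touch it. So [r] has positive value, hence so does the constant term of [r * f], and
   then 1 would too. *)
have gr : 1 <= gauss r.
  rewrite -nE; have := t1' (k + i)%N.
  rewrite sE coefB coef1 addn_eq0 [i == _]eqn0Ngt i0 andbF sub0r /tge oppr_eq0.
  by rewrite (valuN (vp_valuation p_pr)) // => ->.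
apply: n1; have -> : 1 = (shift (1 - r * f))`_0 + (shift (r * f))`_0.
  by rewrite sE coefB coef1 subrK.
exact: (tgeD p_pr (t1' 0%N) (tge_le gr (n_ge 0%N))).
Qed.

End Center.

(** * Irreducible polynomials and their valuations *)

Definition monic_irreducible (q : {poly rat}) : Prop :=
  q \is monic /\ irreducible_poly q.

Lemma size_ltn_mul (R : idomainType) (g h : {poly R}) :
  h != 0 -> (1 < size g)%N -> (size h < size (h * g)%R)%N.
Proof.
move=> h0 g1; have g0 : g != 0 by rewrite -size_poly_gt0; apply: ltnW.
rewrite size_mul //; case: (size g) g1 => [|[|k]] // _.
by rewrite !addnS /= ltnS leq_addr.
Qed.

Lemma exists_monic_irreducible (f : {poly rat}) : (1 < size f)%N ->
  exists q, monic_irreducible q /\ q %| f.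
Proof.
move: {2}(size f) (leqnn (size f)) => n; elim: n f => [|n IH] f sn s1; first by lia.
case: (EM (irreducible_poly f)) => [irr|nirr].
  have f0 : f != 0 := irredp_neq0 irr.
  exists ((lead_coef f)^-1 *: f).
  have c0 : (lead_coef f)^-1 != 0 by rewrite invr_eq0 lead_coef_eq0.
  split; last by rewrite dvdpZl.
  split; first by rewrite monicE lead_coefZ mulVf // lead_coef_eq0.
  case: irr => sf irr; split; first by rewrite size_scale.
  by move=> g sg; rewrite dvdpZr // => /irr h; rewrite (eqp_trans (h sg)) // eqp_sym eqp_scale.
have [g [sg dg ng]] : exists g : {poly rat}, [/\ size g != 1%N, g %| f & ~~ (g %= f)].
  apply: contrapT => h; apply: nirr; split => // g sg dg.
  by apply: contrapT => /negP ng; apply: h; exists g.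
have f0 : f != 0 by rewrite -size_poly_gt0; lia.
have g0 : g != 0 by apply: contraTneq dg => ->; rewrite dvd0p.
have sgf : (size g < size f)%N.
  rewrite ltn_neqAle dvdp_leq // andbT.
  by apply: contra ng; rewrite dvdp_size_eqp.
have sg1 : (1 < size g)%N by rewrite ltn_neqAle eq_sym sg size_poly_gt0.
have [|q [hq dq]] := IH g _ sg1; first by lia.
by exists q; split => //; apply: dvdp_trans dq dg.
Qed.

Section IrreducibleValuation.
Variable q : {poly rat}.
Hypothesis q_irr : irreducible_poly q.

Let q0 : q != 0 := irredp_neq0 q_irr.

Lemma irreducible_dvdpM f g : q %| f * g = (q %| f) || (q %| g).
Proof.
apply/idP/orP => [dfg|[]]; last by move=> /dvdp_mull.
- have [df|ndf] := boolP (q %| f); first by left.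
  by right; move: dfg; rewrite Gauss_dvdpr // irreducible_poly_coprime.
- by move=> /dvdp_mulr.
Qed.

Definition mult_at f (k : nat) : Prop := exists2 g, f = q ^+ k * g & ~~ (q %| g).

Lemma mult_at_exists f : f != 0 -> exists k, mult_at f k.
Proof.
move: {2}(size f) (leqnn (size f)) => n; elim: n f => [|n IH] f sn f0.
  by move: sn; rewrite leqn0 size_poly_eq0 (negbTE f0).
have [df|ndf] := boolP (q %| f); last by exists 0%N, f; rewrite ?expr0 ?mul1r.
have /dvdpP [h E] := df.
have h0 : h != 0 by apply: contraNneq f0 => z; rewrite E z mul0r.
have [|k [g gE ng]] := IH h _ h0.
  by case: q_irr => s1 _; rewrite -ltnS (leq_trans _ sn) // E size_ltn_mul.
by exists k.+1, g; rewrite // E mulrC exprS -mulrA -gE.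
Qed.

Lemma mult_at_uniq f k l : mult_at f k -> mult_at f l -> k = l.
Proof.
wlog kl : k l / (k <= l)%N.
  move=> W hk hl; have /orP[h|h] := leq_total k l; first exact: W.
  by apply/esym/W.
move=> [g -> ng] [h + nh].
have -> : q ^+ l = q ^+ k * q ^+ (l - k) by rewrite -exprD subnKC.
rewrite -mulrA => /(mulfI (expf_neq0 _ q0)) gE.
have [//|klt] := eqVneq k l; case/negP: ng; rewrite gE dvdp_mulr //.
have -> : (l - k = (l - k).-1.+1)%N by lia.
by rewrite exprS dvdp_mulr.
Qed.

Definition qval f : int :=
  if pselect (exists k, mult_at f k) is left h then (projT1 (cid h))%:Z else 0.

Lemma qvalP f k : mult_at f k -> qval f = k%:Z.
Proof.
rewrite /qval => hk; case: pselect => [h|[]]; last by exists k.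
by case: cid => l /= hl; rewrite (mult_at_uniq hl hk).
Qed.

Lemma qval_ge0 f : 0 <= qval f.
Proof. by rewrite /qval; case: pselect. Qed.

Lemma qval_valuation : valuation qval.
Proof.
split=> [f g|m f g] /mult_at_exists [k hk] /mult_at_exists [l hl].
  rewrite (qvalP hk) (qvalP hl) (@qvalP _ (k + l)) //.
  move: hk hl => [f' -> nf] [g' -> ng]; exists (f' * g').
    by rewrite exprD mulrACA.
  by rewrite irreducible_dvdpM negb_or nf.
move=> /mult_at_exists [j hj].
rewrite (qvalP hk) (qvalP hl) (qvalP hj) => mk ml.
have [//|lt] := leP m j%:Z.
move: hk hl hj => [f' fE _] [g' gE _] [h' hE nh]; exfalso; case/negP: nh.
have d : q ^+ j.+1 %| f + g.
  rewrite dvdp_add // ?fE ?gE dvdp_mulr // dvdp_exp2l //; lia.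
move: d; rewrite hE exprSr dvdp_mul2l ?expf_neq0 //.
Qed.

Lemma qval_gt0 f : f != 0 -> (0 < qval f) = (q %| f).
Proof.
move=> /mult_at_exists [k hk]; rewrite (qvalP hk).
move: hk => [g -> ng]; case: k => [|k].
  by rewrite expr0 mul1r (negbTE ng).
by rewrite exprS -mulrA dvdp_mulr.
Qed.

Lemma qval_self : qval q = 1.
Proof.
apply: (@qvalP _ 1%N); exists 1; first by rewrite expr1 mulr1.
by rewrite dvdp1; case: q_irr; lia.
Qed.

End IrreducibleValuation.

Lemma qval_neq q q' : monic_irreducible q -> monic_irreducible q' -> q != q' ->
  qval q q' = 0.
Proof.
move=> [m i] [m' i'] ne; apply/eqP; rewrite eq_le qval_ge0 andbT leNgt.
rewrite qval_gt0 ?(irredp_neq0 i') //; apply/negP => d.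
case/negP: ne; rewrite -eqp_monic //; case: i' => _; apply => //.
by case: i; lia.
Qed.

Lemma qvalC q (a : rat) : irreducible_poly q -> a != 0 -> qval q a%:P = 0.
Proof.
move=> i a0; apply/eqP; rewrite eq_le qval_ge0 andbT leNgt.
rewrite (qval_gt0 i) ?polyC_eq0 //; apply/negP => /dvdp_leq.
by rewrite polyC_eq0 a0 size_polyC a0 => /(_ isT); case: i; lia.
Qed.

Lemma irreducible_divisors_seq (f : {poly rat}) : f != 0 ->
  exists s : seq {poly rat}, forall q, monic_irreducible q -> q %| f -> q \in s.
Proof.
move: {2}(size f) (leqnn (size f)) => n; elim: n f => [|n IH] f sn f0.
  by move: sn; rewrite leqn0 size_poly_eq0 (negbTE f0).
have [s1|s1] := leqP (size f) 1.
  exists [::] => q [_ [sq _]] /(dvdp_leq f0) le.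
  by have := leq_trans sq (leq_trans le s1).
have [p [[mp ip] dp]] := exists_monic_irreducible s1.
have /dvdpP [g E] := dp.
have g0 : g != 0 by apply: contraNneq f0 => z; rewrite E z mul0r.
have [|s hs] := IH g _ g0.
  by case: (ip) => s2 _; rewrite -ltnS (leq_trans _ sn) // E size_ltn_mul.
exists (p :: s) => q hq; rewrite E mulrC (irreducible_dvdpM hq.2) => /orP [d|d].
  rewrite inE; apply/orP; left; rewrite -eqp_monic //; last exact: hq.1.
  by case: ip => _; apply => //; case: hq => _ [+ _]; rewrite neq_ltn => ->; rewrite orbT.
by rewrite inE hs ?orbT.
Qed.

Definition irr_val q : QX -> int := frac_val (qval q).

Lemma irr_val_valuation q : irreducible_poly q -> valuation (irr_val q).
Proof. by move=> i; apply: frac_valuation; apply: qval_valuation. Qed.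

Lemma frac_coprimeP (x : QX) : x != 0 ->
  exists f g, [/\ f != 0, g != 0, coprimep f g & x = f%:F / g%:F].
Proof.
move=> /frac_neq0P [f [g [f0 g0 ->]]].
pose d := gcdp f g.
have d0 : d != 0 by rewrite gcdp_eq0 negb_and f0.
have fE : f %/ d * d = f by rewrite divpK // dvdp_gcdl.
have gE : g %/ d * d = g by rewrite divpK // dvdp_gcdr.
have f'0 : f %/ d != 0 by apply: contraNneq f0 => h; rewrite -fE h mul0r.
have g'0 : g %/ d != 0 by apply: contraNneq g0 => h; rewrite -gE h mul0r.
exists (f %/ d), (g %/ d); split => //; first by rewrite coprimep_div_gcd ?f0.
rewrite -{1}fE -{1}gE !tofracM.
have dF : d%:F != 0 by rewrite tofrac_eq0.
by rewrite -mulf_div divff // mulr1.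
Qed.

Lemma irr_val_ge0_coprime q f g : monic_irreducible q -> f != 0 -> g != 0 ->
  coprimep f g -> 0 <= irr_val q (f%:F / g%:F) -> ~~ (q %| g).
Proof.
move=> [_ i] f0 g0 cfg; rewrite /irr_val (frac_valE (qval_valuation i)) // => ge0.
apply/negP => dg; have := dg; rewrite -(qval_gt0 i) // => qg.
have : q %| f by rewrite -(qval_gt0 i) //; lia.
move=> df; have /dvdp_leq : q %| gcdp f g by rewrite dvdp_gcd df.
move: cfg; rewrite coprimep_def => /eqP sg.
by rewrite -size_poly_eq0 sg => /(_ isT); case: i; lia.
Qed.

(** In lowest terms an irreducible factor of the denominator does not divide the numerator and would
    have a negative value; the denominator is thus constant. *)
Lemma irr_val_poly (x : QX) : x != 0 ->
  (forall q, monic_irreducible q -> 0 <= irr_val q x) -> exists f, x = f%:F.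
Proof.
move=> /frac_coprimeP [f [g [f0 g0 cfg ->]]] h.
have sg : (size g <= 1)%N.
  rewrite leqNgt; apply/negP => /exists_monic_irreducible [q [hq dq]].
  by have := irr_val_ge0_coprime hq f0 g0 cfg (h q hq); rewrite dq.
move: g0 {h cfg}; rewrite (size1_polyC sg) polyC_eq0 => c0.
exists ((g`_0)^-1 *: f).
have c1 : (g`_0)%:P%:F != 0 :> QX by rewrite tofrac_eq0 polyC_eq0.
apply: (canLR (mulfK c1)).
by rewrite -tofracM mulrC mul_polyC scalerA divff // scale1r.
Qed.

Lemma irr_val_const (x : QX) : x != 0 ->
  (forall q, monic_irreducible q -> irr_val q x = 0) ->
  exists2 a : rat, a != 0 & x = a%:P%:F.
Proof.
move=> x0 h; have [|f fE] := irr_val_poly x0.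
  by move=> q /h ->.
have f0 : f != 0 by apply: contraNneq x0 => z; rewrite fE z tofrac0.
have sf : (size f <= 1)%N.
  rewrite leqNgt; apply/negP => /exists_monic_irreducible [q [hq dq]].
  have := h q hq; rewrite fE /irr_val (frac_val_poly (qval_valuation hq.2)) //.
  by move: dq; rewrite -(qval_gt0 hq.2) //; lia.
move: f0 fE; rewrite (size1_polyC sf) polyC_eq0 => c0 ->.
by exists f`_0.
Qed.

Lemma irr_val_support (x : QX) : x != 0 ->
  exists s : seq {poly rat},
    forall q, monic_irreducible q -> irr_val q x != 0 -> q \in s.
Proof.
move=> /frac_neq0P [f [g [f0 g0 ->]]].
have [s hs] := irreducible_divisors_seq f0.
have [t ht] := irreducible_divisors_seq g0.
exists (s ++ t) => q hq; rewrite /irr_val (frac_valE (qval_valuation hq.2)) //.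
rewrite mem_cat => nz.
have [d|nd] := boolP (q %| f); first by rewrite hs.
have [d|nd'] := boolP (q %| g); first by rewrite ht ?orbT.
move: nz nd nd'; rewrite -!(qval_gt0 hq.2) //.
by have := qval_ge0 q f; have := qval_ge0 q g; lia.
Qed.

(** * Divisors of a Krull domain *)

Section Divisors.
Variables (K : fieldType) (InR : K -> Prop).
Variables (J : eqType) (Jin : J -> Prop) (v : J -> K -> int).
Implicit Types (A B : K -> Prop) (D : J -> int) (x y : K).

(** The ideal-theoretic notions are restated for any field and any predicate [InR]; at [QX] and
    [inK R] they unfold to the given ones. *)
Definition frac_idealK A : Prop :=
  A 0 /\ (forall x y, A x -> A y -> A (x + y)) /\
  (forall r x, InR r -> A x -> A (r * x)) /\
  (exists x, A x /\ x != 0) /\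
  (exists d, d != 0 /\ InR d /\ forall x, A x -> InR (d * x)).

Definition colonK A : K -> Prop := fun x => forall a, A a -> InR (x * a).

Definition divisorialK A : Prop :=
  frac_idealK A /\ (forall x, A x <-> colonK (colonK A) x).

Definition vmulK A B : K -> Prop :=
  colonK (fun y => forall a b, A a -> B b -> InR (y * a * b)).

Definition principalK A : Prop :=
  exists x, x != 0 /\ forall y, A y <-> exists r, InR r /\ y = x * r.

Definition finsupp D : Prop :=
  exists s : seq J, forall j, Jin j -> D j != 0 -> j \in s.

Definition above D x : Prop := x != 0 -> forall j, Jin j -> D j <= v j x.

Definition minval A (j : J) (m : int) : Prop :=
  (exists x, [/\ A x, x != 0 & v j x = m]) /\
  (forall x, A x -> x != 0 -> m <= v j x).

Definition div_of A (j : J) : int :=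
  if pselect (exists m, minval A j m) is left h then projT1 (cid h) else 0.

Lemma div_ofP A j m : minval A j m -> div_of A j = m.
Proof.
rewrite /div_of => hm; case: pselect => [h|[]]; last by exists m.
case: cid => n /= [[x [Ax x0 <-]] hn]; case: hm => -[y [Ay y0 <-]] hy.
by apply/eqP; rewrite eq_le hn // hy.
Qed.

Hypothesis vv : forall j, Jin j -> valuation (v j).
Hypothesis InRE : InR = above (fun=> 0).
Hypothesis support : forall x, x != 0 -> finsupp (v^~ x).
Hypothesis nonempty : exists j, Jin j.
(* The valuations are independent enough to realize any finite divisor exactly
   at a prescribed place and up to a nonnegative error elsewhere. *)
Hypothesis approx : forall D j, finsupp D -> Jin j ->
  exists x, [/\ x != 0, forall i, Jin i -> D i <= v i x & v j x = D j].

Lemma finsuppD D D' : finsupp D -> finsupp D' -> finsupp (fun j => D j + D' j).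
Proof.
move=> [s hs] [t ht]; exists (s ++ t) => j hj; rewrite mem_cat.
have [->|n] := eqVneq (D j) 0; first by rewrite add0r => /(ht j hj) ->; rewrite orbT.
by rewrite hs.
Qed.

Lemma finsuppN D : finsupp D -> finsupp (fun j => - D j).
Proof. by move=> [s hs]; exists s => j hj; rewrite oppr_eq0; apply: hs. Qed.

(** A common denominator [d] bounds the values on [A] from below by [- v j d], so a least one
    exists. *)
Lemma minval_exists A j : frac_idealK A -> Jin j -> minval A j (div_of A j).
Proof.
move=> [_ [_ [_ [[a [Aa a0]] [d [d0 [_ hd]]]]]]] hj.
have ge x : A x -> x != 0 -> 0 <= v j x + v j d.
  move=> Ax x0; have := hd x Ax; rewrite InRE => /(_ (mulf_neq0 d0 x0) j hj).
  by rewrite (valuM (vv hj)) // addrC.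
pose P (n : nat) := `[< exists x, [/\ A x, x != 0 & v j x + v j d = n%:Z] >].
have exP : exists n, P n.
  exists (absz (v j a + v j d)); apply/asboolP; exists a; split => //.
  by rewrite gez0_abs // ge.
have [n /asboolP [x [Ax x0 xn]] nmin] := ex_minnP exP.
have h : minval A j (v j x).
  split; first by exists x.
  move=> y Ay y0; have := ge y Ay y0.
  case E : (v j y + v j d) => [k|k] // _.
  have : (n <= k)%N by apply: nmin; apply/asboolP; exists y.
  by lia.
by rewrite (div_ofP h).
Qed.

(** A nonzero element of [A] bounds the minimum from above and a common denominator bounds it from
    below; outside their two supports both bounds are 0. *)
Lemma div_of_finsupp A : frac_idealK A -> finsupp (div_of A).
Proof.
move=> fA; have [_ [_ [_ [[a [Aa a0]] [d [d0 [_ hd]]]]]]] := fA.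
have [s hs] := support a0; have [t ht] := support d0.
exists (s ++ t) => j hj; rewrite mem_cat; apply: contraTT.
rewrite negb_or => /andP [ns nt].
have va : v j a = 0 by apply/eqP; apply: contraNT ns; apply: hs.
have vd : v j d = 0 by apply/eqP; apply: contraNT nt; apply: ht.
have [[x [Ax x0 xm]] le] := minval_exists fA hj.
have := le a Aa a0; have := hd x Ax; rewrite InRE => /(_ (mulf_neq0 d0 x0) j hj).
by rewrite (valuM (vv hj)) // va vd add0r xm => h1 h2; rewrite negbK eq_le h2 h1.
Qed.

Lemma colon_div_of A : frac_idealK A -> colonK A = above (fun j => - div_of A j).
Proof.
move=> fA; apply/funext => y; apply/propext; split.
- move=> hy y0 j hj; have [[x [Ax x0 <-]] _] := minval_exists fA hj.
  have := hy x Ax; rewrite InRE => /(_ (mulf_neq0 y0 x0) j hj).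
  by rewrite (valuM (vv hj)) //; lia.
- move=> hy a Aa; rewrite InRE => n0 j hj.
  have /andP [y0 a0] : (y != 0) && (a != 0) by move: n0; rewrite mulf_eq0 negb_or.
  rewrite (valuM (vv hj)) //; have := hy y0 j hj.
  by have [_ /(_ a Aa a0)] := minval_exists fA hj; lia.
Qed.

(** Approximation provides, for each [j], an element of [above D] with value exactly [D j], which
    forces [- D j <= v j y]. *)
Lemma colon_above D : finsupp D -> colonK (above D) = above (fun j => - D j).
Proof.
move=> fD; apply/funext => y; apply/propext; split.
- move=> hy y0 j hj; have [x [x0 Dx <-]] := approx fD hj.
  have := hy x (fun=> Dx); rewrite InRE => /(_ (mulf_neq0 y0 x0) j hj).
  by rewrite (valuM (vv hj)) //; lia.
- move=> hy a Aa; rewrite InRE => n0 j hj.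
  have /andP [y0 a0] : (y != 0) && (a != 0) by move: n0; rewrite mulf_eq0 negb_or.
  rewrite (valuM (vv hj)) //; have := hy y0 j hj.
  by have := Aa a0 j hj; lia.
Qed.

Lemma colon_aboveN D : finsupp D -> colonK (above (fun j => - D j)) = above D.
Proof.
move=> fD; rewrite colon_above; last exact: finsuppN.
by congr above; apply/funext => j; apply: opprK.
Qed.

Lemma above_frac_ideal D : finsupp D -> frac_idealK (above D).
Proof.
move=> fD; have [j0 hj0] := nonempty.
split; first by rewrite /above eqxx.
split.
  move=> x y hx hy n0 j hj.
  have [x0|x0] := eqVneq x 0; first by rewrite x0 add0r in n0 *; apply: hy.
  have [y0|y0] := eqVneq y 0; first by rewrite y0 addr0 in n0 *; apply: hx.
  by apply: (valuD (vv hj)) => //; [exact: hx|exact: hy].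
split.
  rewrite InRE => r x hr hx n0 j hj.
  have /andP [r0 x0] : (r != 0) && (x != 0) by move: n0; rewrite mulf_eq0 negb_or.
  by rewrite (valuM (vv hj)) //; have := hr r0 j hj; have := hx x0 j hj; lia.
split; first by have [x [x0 hx _]] := approx fD hj0; exists x; split=> [_|].
(* A common denominator only has to offset the negative part of [D]. *)
have [||d [d0 hd _]] := @approx (fun j => if D j <= 0 then - D j else 0) j0.
- by have [s hs] := fD; exists s => j hj; case: ifP => // _; rewrite oppr_eq0; apply: hs.
- by [].
exists d; split => //; split.
  by rewrite InRE => _ j hj; have := hd j hj; case: ifP; lia.
rewrite InRE => x hx n0 j hj.
have x0 : x != 0 by move: n0; rewrite mulf_eq0 negb_or => /andP [].
rewrite (valuM (vv hj)) //; have := hd j hj; have := hx x0 j hj.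
by case: ifP; lia.
Qed.

Lemma div_of_above D j : finsupp D -> Jin j -> div_of (above D) j = D j.
Proof.
move=> fD hj; apply: div_ofP; split.
  by have [x [x0 Dx <-]] := approx fD hj; exists x; split=> // _.
by move=> x hx x0; apply: hx.
Qed.

Lemma above_divisorial D : finsupp D -> divisorialK (above D).
Proof.
move=> fD; split; first exact: above_frac_ideal.
by move=> x; rewrite colon_above // (colon_aboveN fD).
Qed.

(** A divisorial ideal is its own double colon, and each colon negates the divisor. *)
Lemma divisorialE A : divisorialK A -> A = above (div_of A).
Proof.
move=> [fA AE]; apply/funext => x; apply/propext; rewrite AE (colon_div_of fA).
by rewrite (colon_aboveN (div_of_finsupp fA)).
Qed.

Lemma vmulE A B : divisorialK A -> divisorialK B ->
  vmulK A B = above (fun j => div_of A j + div_of B j).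
Proof.
move=> [fA _] [fB _].
have fAB := finsuppD (div_of_finsupp fA) (div_of_finsupp fB).
rewrite /vmulK.
have -> : (fun y => forall a b, A a -> B b -> InR (y * a * b)) =
    above (fun j => - (div_of A j + div_of B j)).
  apply/funext => y; apply/propext; split.
  - move=> hy y0 j hj; have [[a [Aa a0 <-]] _] := minval_exists fA hj.
    have [[b [Bb b0 <-]] _] := minval_exists fB hj.
    have := hy a b Aa Bb; rewrite InRE => /(_ _ j hj).
    by rewrite !mulf_neq0 // => /(_ isT); rewrite !(valuM (vv hj)) ?mulf_neq0 //; lia.
  - move=> hy a b Aa Bb; rewrite InRE => n0 j hj.
    move: n0; rewrite !mulf_eq0 !negb_or => /andP [/andP [y0 a0] b0].
    rewrite !(valuM (vv hj)) ?mulf_neq0 //; have := hy y0 j hj.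
    have [_ /(_ a Aa a0)] := minval_exists fA hj.
    by have [_ /(_ b Bb b0)] := minval_exists fB hj; lia.
exact: colon_aboveN fAB.
Qed.

Lemma principal_above D : finsupp D ->
  principalK (above D) <-> exists f, f != 0 /\ forall j, Jin j -> D j = v j f.
Proof.
move=> fD; split=> [[f [f0 fE]]|[f [f0 fE]]]; exists f; split => //.
- move=> j hj; apply/eqP; rewrite eq_le; apply/andP; split.
    suff : above D f by apply.
    apply/fE; exists 1; rewrite mulr1 InRE; split => // n1 i hi.
    by rewrite (valu1 (vv hi)).
  (* An element attaining [D j] is a multiple of the generator, so [v j f] cannot exceed [D j]. *)
  have [x [x0 Dx <-]] := approx fD hj.
  have /fE [r [+ xE]] : above D x by move=> _.
  have r0 : r != 0 by apply: contraNneq x0 => z; rewrite xE z mulr0.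
  by rewrite InRE => /(_ r0 j hj); rewrite xE (valuM (vv hj)) //; lia.
- move=> y; split=> [hy|[r [hr ->]] n0 j hj].
    exists (y / f); rewrite [f * _]mulrC divfK //; split => //.
    rewrite InRE => n0 j hj.
    have y0 : y != 0 by move: n0; rewrite mulf_eq0 negb_or => /andP [].
    by rewrite (valu_div (vv hj)) //; have := hy y0 j hj; rewrite fE //; lia.
  have r0 : r != 0 by move: n0; rewrite mulf_eq0 negb_or => /andP [].
  move: hr; rewrite InRE (valuM (vv hj)) // fE // => /(_ r0 j hj); lia.
Qed.

Variables (H : Type) (Hin : H -> Prop) (add : H -> H -> H) (zero : H).
Variable cls : (J -> int) -> H.
Hypothesis cls_ext : forall D D', (forall j, Jin j -> D j = D' j) -> cls D = cls D'.
Hypothesis cls_in : forall D, finsupp D -> Hin (cls D).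
Hypothesis clsD : forall D D', finsupp D -> finsupp D' ->
  cls (fun j => D j + D' j) = add (cls D) (cls D').
Hypothesis cls_eq0 : forall D, finsupp D ->
  (cls D = zero <-> exists f, f != 0 /\ forall j, Jin j -> D j = v j f).
Hypothesis cls_onto : forall h, Hin h -> exists2 D, finsupp D & cls D = h.

Lemma class_group_iso : exists phi : (K -> Prop) -> H,
    (forall A B, divisorialK A -> divisorialK B ->
       (forall x, A x <-> B x) -> phi A = phi B) /\
    (forall A, divisorialK A -> Hin (phi A)) /\
    (forall h, Hin h -> exists A, divisorialK A /\ phi A = h) /\
    (forall A B, divisorialK A -> divisorialK B ->
       phi (vmulK A B) = add (phi A) (phi B)) /\
    (forall A, divisorialK A -> (phi A = zero <-> principalK A)).
Proof.
exists (fun A => cls (div_of A)).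
split; first by move=> A B _ _ /predeqP ->.
split; first by move=> A [fA _]; apply/cls_in/div_of_finsupp.
split.
  move=> h /cls_onto [D fD <-]; exists (above D); split; first exact: above_divisorial.
  by apply: cls_ext => j; apply: div_of_above.
split.
  move=> A B dA dB; have [[fA _] [fB _]] := (dA, dB).
  have fsA := div_of_finsupp fA; have fsB := div_of_finsupp fB.
  rewrite vmulE // -clsD //; apply: cls_ext => j.
  by apply: div_of_above; apply: finsuppD.
move=> A dA; have [fA _] := dA; have fs := div_of_finsupp fA.
by rewrite cls_eq0 // -principal_above // -divisorialE.
Qed.

End Divisors.

(** * A family of places with finite character *)

Lemma exists_nonroot (Q : {poly int}) : Q != 0 -> exists c, Q.[c] != 0.
Proof.
move=> Q0; apply: contrapT => h.
have : all (root Q) [seq i%:Z | i <- iota 0 (size Q)].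
  apply/allP => c _; apply: contrapT => n; apply: h; exists c.
  by apply/negP => /eqP z; apply: n; apply/rootP.
move/(max_poly_roots Q0); rewrite size_map size_iota ltnn => /(_ _).
by rewrite map_inj_uniq ?iota_uniq // => [/(_ isT)|i j []].
Qed.

Lemma logn_small p a : (0 < a)%N -> (a < p)%N -> logn p a = 0%N.
Proof.
move=> a0 ap; apply/eqP; rewrite eqn0Ngt logn_gt0 mem_primes a0 /=.
by apply/negP => /andP [_ /(dvdn_leq a0)]; rewrite leqNgt ap.
Qed.

Definition good_place (L : seq {poly int}) (B : nat) (pc : nat * (bool -> int)) :=
  [/\ prime pc.1, (B < pc.1)%N,
      pc.2 true - pc.2 false != 0 /\ logn pc.1 `|pc.2 true - pc.2 false| = 0%N &
      forall q b, q \in L -> q != 0 ->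
        q.[pc.2 b] != 0 /\ logn pc.1 `|q.[pc.2 b]| = 0%N].

(** Two distinct non-roots of the product [Q] serve as centers. A prime above [B] and above the
    sizes of [c1 - c2] and of the values of [Q] at both cannot divide these nonzero integers, nor
    their factors. *)
Lemma good_place_exists L B : exists pc, good_place L B pc.
Proof.
pose Q := \prod_(q <- L | q != 0) q.
have Q0 : Q != 0 by rewrite prodf_seq_neq0; apply/allP => q _; apply/implyP.
have [c1 h1] := exists_nonroot Q0.
have [c2] : exists c, (Q * ('X - c1%:P)).[c] != 0.
  by apply: exists_nonroot; rewrite mulf_neq0 // polyXsubC_eq0.
rewrite hornerM hornerXsubC mulf_eq0 negb_or => /andP [h2 h12].
have [p hp p_pr] := prime_above (B + `|Q.[c1]| + `|Q.[c2]| + `|c1 - c2|)%N.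
exists (p, fun b : bool => if b then c1 else c2); split => //=.
- by apply: leq_ltn_trans hp; rewrite -!addnA leq_addr.
- have n0 : c1 - c2 != 0 by rewrite -opprB oppr_eq0.
  by split=> //; apply: logn_small; [rewrite absz_gt0|apply: leq_ltn_trans hp; rewrite leq_addl].
move=> q b qL q0; set c := if b then _ else _.
have Qc : Q.[c] != 0 by rewrite /c; case: b {c}.
have lp : (`|Q.[c]| < p)%N by rewrite /c; case: b {c Qc}; lia.
have E : exists r, Q = q * r.
  by exists (\prod_(i <- rem q L | i != 0) i); rewrite /Q (big_rem q) //= q0.
move: E => [r E]; move: Qc lp; rewrite E hornerM mulf_eq0 negb_or abszM => /andP [qc rc] lt.
split=> //; apply: logn_small; first by rewrite absz_gt0.
by apply: leq_ltn_trans lt; rewrite leq_pmulr // absz_gt0.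
Qed.

(** Diagonal choice along an enumeration of Z[X]: the [n]-th place is good for all polynomials of
    code below [n] and its prime exceeds the previous one, so each nonzero polynomial is a unit
    beyond its own code. *)
Lemma places_exist : exists (P : nat -> nat) (C : nat -> bool -> int),
  [/\ forall n, prime (P n), injective P,
      forall n, C n true - C n false != 0 /\
        logn (P n) `|C n true - C n false| = 0%N &
      forall q : {poly int}, q != 0 -> exists N, forall n b, (N <= n)%N ->
        q.[C n b] != 0 /\ logn (P n) `|q.[C n b]| = 0%N].
Proof.
pose L n : seq {poly int} := pmap unpickle (iota 0 n).
have /choice [F hF] : forall nB : nat * nat, exists pc, good_place (L nB.1) nB.2 pc.
  by move=> nB; apply: good_place_exists.
pose fix pc n := F (n, if n is m.+1 then (pc m).1 else 0%N).
have hpc n : good_place (L n) (if n is m.+1 then (pc m).1 else 0%N) (pc n).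
  by case: n => [|n]; apply: hF.
have lt n : ((pc n).1 < (pc n.+1).1)%N by have [] := hpc n.+1.
exists (fun n => (pc n).1), (fun n => (pc n).2); split.
- by move=> n; have [] := hpc n.
- apply: incn_inj; apply: leq_mono.
  by apply: homo_ltn => //; exact: ltn_trans.
- by move=> n; have [] := hpc n.
move=> q q0; exists (pickle q).+1 => n b Nn; have [_ _ _] := hpc n; apply => //.
by rewrite mem_pmap; apply/mapP; exists (pickle q); rewrite ?pickleK // mem_iota.
Qed.

Lemma rat_poly_int (f : {poly rat}) : exists (q : {poly int}) (a : int),
  a != 0 /\ a%:~R * f = map_poly intr q.
Proof.
have [q [a a0 E]] := rat_poly_scale f; exists q, a; split => //.
have -> : a%:~R = (a%:~R : rat)%:P by rewrite rmorph_int.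
by rewrite E mul_polyC scalerA divff ?scale1r ?intr_eq0.
Qed.

Lemma int_polyP f : int_poly f -> exists q : {poly int}, f = map_poly intr q.
Proof.
move=> h; exists (map_poly numq f); apply/polyP => i.
rewrite coef_map /= coef_map_id0 // numqE.
by move: (h i); rewrite Qint_def => /eqP ->; rewrite mulr1.
Qed.

(** * Values at the chosen places, and functions with prescribed values *)

Section Family.
Variables (P : nat -> nat) (C : nat -> bool -> int) (o : nat -> nat).
Hypothesis P_pr : forall n, prime (P n).
Hypothesis P_inj : injective P.
Hypothesis C_sep : forall n, C n true - C n false != 0 /\
  logn (P n) `|C n true - C n false| = 0%N.
Hypothesis C_fin : forall q : {poly int}, q != 0 -> exists N, forall n b, (N <= n)%N ->
  q.[C n b] != 0 /\ logn (P n) `|q.[C n b]| = 0%N.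

(* [o n] is the order of the [n]-th cyclic summand, [0] meaning infinite order. *)
Definition ram (n : nat) : nat := if o n == 0%N then 1%N else o n.

Lemma ram_gt0 n : (0 < ram n)%N.
Proof. by rewrite /ram; case: ifP => // /negbT; rewrite -lt0n. Qed.

Definition place n b : {poly rat} -> int := gauss (P n) (ram n) (C n b).

Lemma place_valuation n b : valuation (place n b).
Proof. exact: gauss_valuation (P_pr n). Qed.

Lemma placeC n b (a : rat) : a != 0 -> place n b a%:P = (ram n)%:Z * vp (P n) a.
Proof. exact: gaussC (P_pr n) _. Qed.

Lemma place_intC n b (a : int) : a != 0 ->
  place n b a%:~R = (ram n)%:Z * (logn (P n) `|a|)%:Z.
Proof. exact: gauss_int (P_pr n) _. Qed.

Definition center n b : {poly rat} := 'X - (C n b)%:~R%:P.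

Lemma center_neq0 n b : center n b != 0.
Proof. by rewrite polyXsubC_eq0. Qed.

Lemma place_center n b : place n b (center n b) = 1.
Proof. exact: gauss_center (P_pr n). Qed.

(** At the center of the place, [center n (~~ b)] evaluates to the difference of the centers up to
    sign, prime to [P n] by [C_sep]. *)
Lemma place_other_center n b : place n b (center n (~~ b)) = 0.
Proof.
have -> : center n (~~ b) = map_poly intr ('X - (C n (~~ b))%:P).
  by rewrite /center rmorphB /= map_polyX map_polyC.
have [h1 h2] := C_sep n.
apply: min_term_unit; rewrite ?hornerXsubC; case: b => //=.
- by rewrite -opprB oppr_eq0.
- by rewrite -opprB abszN.
Qed.

Lemma place_int_ge0 n b (q : {poly int}) : 0 <= place n b (map_poly intr q).
Proof. exact: gauss_int_ge0 (P_pr n) _. Qed.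

Lemma place_center_ge0 m c n b : 0 <= place m c (center n b).
Proof.
have -> : center n b = map_poly intr ('X - (C n b)%:P).
  by rewrite /center rmorphB /= map_polyX map_polyC.
exact: place_int_ge0.
Qed.

Lemma place0 n b : place n b 0 = 0.
Proof. exact: gauss0. Qed.

Lemma place_finite (f : {poly rat}) : f != 0 ->
  exists N, forall n b, (N <= n)%N -> place n b f = 0.
Proof.
move=> f0; have [q [a [a0 E]]] := rat_poly_int f.
have aP0 : (a%:~R : {poly rat}) != 0.
  by rewrite -[a%:~R](rmorph_int (@polyC _)) polyC_eq0 intr_eq0.
have q0 : q != 0.
  by apply: contraNneq (mulf_neq0 aP0 f0) => z; rewrite E z rmorph0.
have [N hN] := C_fin q0.
(* The denominator [a], seen as a constant polynomial, is also prime to almost all [P n]. *)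
have [M hM] : exists N, forall n b, (N <= n)%N ->
    a%:P.[C n b] != 0 /\ logn (P n) `|a%:P.[C n b]| = 0%N.
  by apply: C_fin; rewrite polyC_eq0.
exists (maxn N M) => n b; rewrite geq_max => /andP [Nn Mn].
have [h1 h2] := hN n b Nn; have [_] := hM n b Mn; rewrite hornerC => la.
have := min_term_unit (ram n) (P_pr n) h1 h2; rewrite -E -/(place n b _).
by rewrite (valuM (place_valuation n b)) // place_intC // la mulr0 add0r.
Qed.

Lemma vp_P m n : vp (P m) ((P n)%:Z)%:~R = (m == n)%:Z.
Proof.
rewrite vp_int ?P_pr //; last by have := prime_gt0 (P_pr n); lia.
by rewrite /vpz /= logn_prime // (inj_eq P_inj).
Qed.

Lemma vp_exists (s : seq nat) (m : nat -> int) : (forall n, n \notin s -> m n = 0) ->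
  exists2 a : rat, a != 0 & forall n, vp (P n) a = m n.
Proof.
elim: s m => [|k s IH] m hm.
  by exists 1 => // n; rewrite (valu1 (vp_valuation (P_pr n))) hm.
have [n hn|a a0 ha] := IH (fun n => if n == k then 0 else m n).
  by case: eqP => // /eqP nk; rewrite hm // inE negb_or nk.
have P0 : ((P k)%:Z)%:~R != 0 :> rat.
  by rewrite intr_eq0; have := prime_gt0 (P_pr k); lia.
exists (a * ((P k)%:Z)%:~R ^ m k) => [|n]; first by rewrite mulf_neq0 // expfz_neq0.
rewrite (valuM (vp_valuation (P_pr n))) ?expfz_neq0 //.
rewrite (valuXz (vp_valuation (P_pr n))) // ha vp_P.
by case: eqP => [->|]; rewrite ?mul1r ?mul0r ?add0r ?addr0.
Qed.

Lemma irr_val_self q : monic_irreducible q -> irr_val q q%:F = 1.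
Proof.
move=> [_ i]; rewrite /irr_val (frac_val_poly (qval_valuation i)) ?(irredp_neq0 i) //.
exact: qval_self.
Qed.

Lemma irr_val_neq q q' : monic_irreducible q -> monic_irreducible q' -> q != q' ->
  irr_val q q'%:F = 0.
Proof.
move=> h h' ne; rewrite /irr_val (frac_val_poly (qval_valuation h.2)) ?(irredp_neq0 h'.2) //.
exact: qval_neq.
Qed.

Lemma irr_val_exists (s : seq {poly rat}) (m : {poly rat} -> int) :
  (forall q, monic_irreducible q -> q \notin s -> m q = 0) ->
  exists2 x : QX, x != 0 & forall q, monic_irreducible q -> irr_val q x = m q.
Proof.
elim: s m => [|k s IH] m hm.
  exists 1; first exact: oner_neq0.
  by move=> q hq; rewrite (valu1 (irr_val_valuation hq.2)) hm.
case: (EM (monic_irreducible k)) => [ik|nk]; last first.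
  apply: IH => q hq qs; apply: hm => //; rewrite inE negb_or qs andbT.
  by apply: contra_notN nk => /eqP <-.
have [q hq qs|x x0 hx] := IH (fun q => if q == k then 0 else m q).
  by case: eqP => // /eqP nk; rewrite hm // inE negb_or nk.
have k0 : k%:F != 0 :> QX by rewrite tofrac_eq0 (irredp_neq0 ik.2).
have kz : k%:F ^ m k != 0 :> QX := expfz_neq0 _ k0.
exists (x * k%:F ^ m k) => [|q hq]; first exact: mulf_neq0 x0 kz.
have vq := irr_val_valuation hq.2.
rewrite (valuM vq x0 kz) (valuXz vq _ k0) hx //.
have [->|ne] := eqVneq q k; first by rewrite irr_val_self // mul1r add0r.
by rewrite irr_val_neq // mul0r addr0.
Qed.

(** * Essential valuations of the ring attached to a set of primes, and their approximation *)

Variable U : nat -> Prop.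

(** [U] selects the primes that stay non-invertible; the second place over such a prime is switched
    on only for infinite order. *)
Definition active n (b : bool) : Prop := U n /\ (b -> o n = 0%N).

Definition ring_at : {poly rat} -> Prop :=
  fun f => forall n b, active n b -> 0 <= place n b f.

Notation J := ({poly rat} + nat * bool)%type.
Implicit Type D : J -> int.

Definition ess (j : J) : Prop :=
  match j with inl q => monic_irreducible q | inr t => active t.1 t.2 end.

Definition ess_val (j : J) : QX -> int :=
  match j with inl q => irr_val q | inr t => frac_val (place t.1 t.2) end.

Lemma ess_valuation j : ess j -> valuation (ess_val j).
Proof.
case: j => [q|t] /=; first by move=> [_ i]; apply: irr_val_valuation.
by move=> _; apply: frac_valuation; apply: place_valuation.
Qed.

Lemma ess_val_place n (b : bool) (f : {poly rat}) : f != 0 -> ess_val (inr (n, b)) f%:F = place n b f.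
Proof. exact: frac_val_poly (place_valuation n b) _. Qed.

Lemma ess_val_irr (q f : {poly rat}) : monic_irreducible q -> f != 0 ->
  ess_val (inl q) f%:F = qval q f.
Proof. by move=> [_ i]; exact: frac_val_poly (qval_valuation i) _. Qed.

Lemma inK_ring_at : inK ring_at = above ess ess_val (fun=> 0).
Proof.
apply/funext => x; apply/propext; split.
- move=> [f [hf ->]]; rewrite /above tofrac_eq0 => f0 [q|[n b]] hj.
    by rewrite ess_val_irr // qval_ge0.
  by rewrite ess_val_place //; apply: hf.
- move=> h; have [->|x0] := eqVneq x 0.
    by exists 0; split; [move=> n b _; rewrite place0|rewrite tofrac0].
  have [|f fE] := irr_val_poly x0; first by move=> q hq; exact: (h x0 (inl q) hq).
  exists f; split=> // n b hnb.
  have f0 : f != 0 by apply: contraNneq x0 => z; rewrite fE z tofrac0.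
  by rewrite -ess_val_place // -fE; exact: (h x0 (inr (n, b)) hnb).
Qed.

Lemma mem_places N n (b : bool) : (n < N)%N ->
  (n, b) \in [seq (n, b) | n <- iota 0 N, b <- [:: true; false]].
Proof.
move=> h; apply/allpairsP; exists (n, b); rewrite mem_iota /= add0n h.
by split=> //; case: b.
Qed.

Lemma ess_support (x : QX) : x != 0 -> finsupp ess (ess_val^~ x).
Proof.
move=> x0; have [s hs] := irr_val_support x0.
have [f [g [f0 g0 xE]]] := frac_neq0P x0.
have [N hN] := place_finite f0; have [M hM] := place_finite g0.
pose t := [seq (n, b) | n <- iota 0 (maxn N M), b <- [:: true; false]].
exists ([seq inl q | q <- s] ++ [seq inr u | u <- t]) => -[q|[n b]] hj nz;
  rewrite mem_cat.
  by rewrite map_f // hs.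
apply/orP; right; apply: map_f; apply: mem_places.
rewrite ltnNge; apply: contra nz; rewrite geq_max => /andP [h1 h2].
rewrite xE /= (frac_valE (place_valuation n b)) //.
by rewrite hN // hM // subrr.
Qed.

Lemma finsupp_bound D : finsupp ess D ->
  exists M : nat, forall j, ess j -> - M%:Z <= D j /\ D j <= M%:Z.
Proof.
move=> [s hs]; exists (\max_(j <- s) `|D j|%N)%N => j hj.
have [z|nz] := eqVneq (D j) 0; first by rewrite z; split; lia.
have := @leq_bigmax_seq _ s xpredT (fun j => `|D j|%N) j (hs j hj nz) isT.
by move: (\max_(_ <- _) _)%N => M; lia.
Qed.

Definition irr_indices (s : seq J) : seq {poly rat} :=
  pmap (fun j => if j is inl q then Some q else None) s.

Definition place_indices (s : seq J) : seq nat :=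
  pmap (fun j => if j is inr t then Some t.1 else None) s.

Lemma mem_irr_indices s q : inl q \in s -> q \in irr_indices s.
Proof. by move=> h; rewrite mem_pmap; apply/mapP; exists (inl q). Qed.

Lemma mem_place_indices s t : inr t \in s -> t.1 \in place_indices s.
Proof. by move=> h; rewrite mem_pmap; apply/mapP; exists (inr t). Qed.

Lemma irr_part_exists D : finsupp ess D ->
  exists2 x : QX, x != 0 & forall q, monic_irreducible q -> irr_val q x = D (inl q).
Proof.
move=> [s hs]; apply: (@irr_val_exists (irr_indices s) (fun q => D (inl q))) => q hq.
by move=> nq; apply/eqP; apply: contraNT nq => nz; apply/mem_irr_indices/hs.
Qed.

(** Exponent [M] suffices at the primes of [t] since [ram n] is at least 1; at the remaining ones
    [D] vanishes. *)
Lemma polyC_place_exists (M : nat) (D : J -> int) (t : seq nat) (c : int) n0 :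
  (forall j, ess j -> D j <= M%:Z) ->
  (forall n b, active n b -> n \notin t -> D (inr (n, b)) = 0) ->
  exists a : rat, [/\ a != 0, vp (P n0) a = c &
    forall n b, active n b -> n != n0 -> D (inr (n, b)) <= (ram n)%:Z * vp (P n) a].
Proof.
move=> hM ht.
have [n|a a0 ha] := @vp_exists (n0 :: t)
    (fun n => if n == n0 then c else if n \in t then M%:Z else 0).
  by rewrite inE negb_or => /andP [/negbTE -> /negbTE ->].
exists a; split => //; first by rewrite ha eqxx.
move=> n b hnb nn0; rewrite ha (negbTE nn0); case: ifP => [_|/negbT nt].
  have := hM (inr (n, b)) hnb; have := ram_gt0 n.
  by move: (D _) (ram n) => d r; nia.
by rewrite mulr0 (ht n b hnb).
Qed.

(** The function must be a polynomial, to be nonnegative at the irreducibles, so only nonnegative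
    powers of the centers are allowed. A constant therefore first lowers both places over [P n] by
    [ram n * M]; powers of the two centers then raise each to its target. *)
Lemma place_approx D n b : finsupp ess D -> active n b ->
  exists f : {poly rat}, [/\ f != 0,
    forall m c, active m c -> D (inr (m, c)) <= place m c f &
    place n b f = D (inr (n, b))].
Proof.
move=> fD hnb; have [M hM] := finsupp_bound fD; have [s hs] := fD.
have ht m c : active m c -> m \notin place_indices s -> D (inr (m, c)) = 0.
  move=> h nm; apply/eqP; apply: contraNT nm => nz.
  by have /mem_place_indices := hs (inr (m, c)) h nz.
have [a [a0 an ha]] := polyC_place_exists (- M%:Z) n (fun j hj => (hM j hj).2) ht.
(* At an active place the sum is nonnegative by the choice of [M]; at an inactive one any exponent
   will do. *)
pose k c := absz (D (inr (n, c)) + (ram n)%:Z * M%:Z).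
pose f := a%:P * center n b ^+ k b * center n (~~ b) ^+ k (~~ b).
have aP0 : a%:P != 0 :> {poly rat} by rewrite polyC_eq0.
have c0 c i : center n c ^+ i != 0 by rewrite expf_neq0 // center_neq0.
have f0 : f != 0 by rewrite !mulf_neq0.
have fE m c : place m c f = (ram m)%:Z * vp (P m) a +
    place m c (center n b) * (k b)%:Z + place m c (center n (~~ b)) * (k (~~ b))%:Z.
  have vm := place_valuation m c.
  rewrite (valuM vm) ?mulf_neq0 // (valuM vm) // placeC //.
  by rewrite !(valuX vm) ?center_neq0.
have kE c : active n c -> (k c)%:Z = D (inr (n, c)) + (ram n)%:Z * M%:Z.
  move=> hc; rewrite gez0_abs //; have [+ _] := hM (inr (n, c)) hc.
  by have := ram_gt0 n; move: (D _) (ram n) => d r; nia.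
have fn c : active n c -> place n c f = D (inr (n, c)).
  move=> hc; rewrite fE an; have [E|ne] := eqVneq c b.
    rewrite -E place_center place_other_center mul0r mul1r kE //; ring.
  have cE : c = ~~ b by case: (c) (b) ne => [] [].
  have bE : b = ~~ c by rewrite cE negbK.
  rewrite -cE {1}bE place_other_center place_center mul0r mul1r kE //; ring.
exists f; split; [by []| |exact: fn].
move=> m c hmc; have [E|mn] := eqVneq m n.
  by move: hmc; rewrite E => hc; rewrite fn.
rewrite fE; have := ha m c hmc mn.
have := mulr_ge0 (place_center_ge0 m c n b) (isT : 0 <= (k b)%:Z).
have := mulr_ge0 (place_center_ge0 m c n (~~ b)) (isT : 0 <= (k (~~ b))%:Z).
by move=> h1 h2 h3; rewrite -addrA (le_trans h3) // lerDl addr_ge0.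
Qed.

Lemma ess_approx D j : finsupp ess D -> ess j ->
  exists x, [/\ x != 0, forall i, ess i -> D i <= ess_val i x & ess_val j x = D j].
Proof.
move=> fD hj; have [g g0 hg] := irr_part_exists fD.
(* As [g] matches [D] at the irreducibles, a polynomial correction can only raise those values. *)
pose D' i := D i + - ess_val i g.
have fD' : finsupp ess D'.
  apply: finsuppD fD _; apply: finsuppN; exact: ess_support.
suff [f [f0 hf fj]] : exists f : {poly rat}, [/\ f != 0,
    forall m c, active m c -> D' (inr (m, c)) <= place m c f &
    ess_val j f%:F = D' j].
  have fF : f%:F != 0 :> QX by rewrite tofrac_eq0.
  exists (g * f%:F); split; first exact: mulf_neq0 g0 fF.
    move=> i hi; rewrite (valuM (ess_valuation hi) g0 fF).
    case: i hi => [q|[n b]] hi; last by rewrite ess_val_place // -lerBlDl; exact: hf.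
    by rewrite ess_val_irr // /= hg // lerDl qval_ge0.
  by rewrite (valuM (ess_valuation hj) g0 fF) fj /D' addrC subrK.
case: j hj => [q|[n b]] hj; last first.
  have [f [f0 hf fE]] := place_approx fD' hj.
  by exists f; rewrite ess_val_place.
have [M hM] := finsupp_bound fD'; have [s hs] := fD'.
have ht m c : active m c -> m \notin place_indices s -> D' (inr (m, c)) = 0.
  move=> h nm; apply/eqP; apply: contraNT nm => nz.
  by have /mem_place_indices := hs (inr (m, c)) h nz.
(* To stay exact at an irreducible [j] the correction is taken constant. The index 0 is an arbitrary
   [n0], given the same large exponent as the others. *)
have [a [a0 an ha]] := polyC_place_exists M%:Z 0%N (fun i hi => (hM i hi).2) ht.
exists a%:P; split; rewrite ?polyC_eq0 //.
  move=> m c hmc; rewrite placeC //; have [E|m0] := eqVneq m 0%N; last exact: ha.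
  rewrite E an; have [_] := hM (inr (m, c)) hmc; rewrite E; have := ram_gt0 0%N.
  by move: (D' _) (ram 0) => d r; nia.
rewrite ess_val_irr ?polyC_eq0 // qvalC //; last by case: hj.
by rewrite /D' /= hg // subrr.
Qed.

(** * The rings [ring_at] are pure Krull domains *)

Definition vpos n b f : Prop := f != 0 -> 0 < place n b f.

Lemma placeD_ge0 n b f g :
  0 <= place n b f -> 0 <= place n b g -> 0 <= place n b (f + g).
Proof.
have [->|f0] := eqVneq f 0; first by rewrite add0r.
have [->|g0] := eqVneq g 0; first by rewrite addr0.
have [->|s0] := eqVneq (f + g) 0; first by rewrite place0.
exact: (valuD (place_valuation n b)).
Qed.

Lemma placeM_ge0 n b f g :
  0 <= place n b f -> 0 <= place n b g -> 0 <= place n b (f * g).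
Proof.
have [->|f0] := eqVneq f 0; first by rewrite mul0r.
have [->|g0] := eqVneq g 0; first by rewrite mulr0.
by rewrite (valuM (place_valuation n b)) //; apply: addr_ge0.
Qed.

Lemma placeN n b f : place n b (- f) = place n b f.
Proof.
have [->|f0] := eqVneq f 0; first by rewrite oppr0.
exact: (valuN (place_valuation n b)).
Qed.

Lemma vposD n b f g : vpos n b f -> vpos n b g -> vpos n b (f + g).
Proof.
have [->|f0] := eqVneq f 0; first by rewrite add0r.
have [->|g0] := eqVneq g 0; first by rewrite addr0.
move=> /(_ f0) hf /(_ g0) hg s0.
by rewrite gtz0_ge1; apply: (valuD (place_valuation n b)); rewrite // -gtz0_ge1.
Qed.

Lemma vposM n b f g : 0 <= place n b f -> vpos n b g -> vpos n b (f * g).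
Proof.
move=> hf hg; rewrite /vpos mulf_eq0 negb_or => /andP [f0 g0].
by rewrite (valuM (place_valuation n b)) //; apply: ltr_wpDl => //; apply: hg.
Qed.

Lemma ring_at_subring : subring ring_at.
Proof.
split; first by move=> n b _; rewrite (valu1 (place_valuation n b)).
split=> f g hf hg n b h; last by apply: placeM_ge0; [apply: hf|apply: hg].
by apply: placeD_ge0; rewrite ?placeN; [apply: hf|apply: hg].
Qed.

Lemma ring_at_between : poly_ring_between ring_at.
Proof.
split; first exact: ring_at_subring.
by move=> f /int_polyP [q ->] n b _; apply: place_int_ge0.
Qed.

Lemma ring_at1 : ring_at 1.
Proof. by case: ring_at_subring. Qed.

Lemma ring_atM f g : ring_at f -> ring_at g -> ring_at (f * g).
Proof. by case: ring_at_subring => _ [_]; apply. Qed.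

Lemma ring_at0 : ring_at 0.
Proof. by move=> n b _; rewrite place0. Qed.

Lemma ring_atD f g : ring_at f -> ring_at g -> ring_at (f + g).
Proof. by move=> hf hg n b h; apply: placeD_ge0; [apply: hf|apply: hg]. Qed.

Lemma ring_at_krull : krull ring_at.
Proof.
split; first exact: ring_at_subring.
exists (fun v => exists j, ess j /\ v = ess_val j); split.
  move=> _ [[q|[n b]] [hj ->]].
    have k0 : q%:F != 0 :> QX by rewrite tofrac_eq0; exact: irredp_neq0 hj.2.
    exact: valuation_discrete (ess_valuation hj) k0 (irr_val_self hj).
  have k0 : (center n b)%:F != 0 :> QX by rewrite tofrac_eq0 center_neq0.
  apply: valuation_discrete (ess_valuation hj) k0 _.
  by rewrite ess_val_place ?center_neq0 // place_center.
split.
  move=> x x0; rewrite inK_ring_at; split=> [h v [j [hj ->]]|h _ j hj].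
    exact: h.
  by apply: h; exists j.
move=> x x0; have [s hs] := ess_support x0.
exists (size s), (fun i => ess_val (nth (inl 0) s i)) => _ [j [hj ->]] nz.
have js := hs j hj nz.
by exists (index j s); rewrite index_mem js nth_index.
Qed.

Definition place_ideal n b f : Prop := ring_at f /\ vpos n b f.

Lemma place_ideal_prime n b : active n b -> prime_ideal ring_at (place_ideal n b).
Proof.
move=> hnb; split.
  split; first by move=> f [].
  split; first by split; [exact: ring_at0|rewrite /vpos eqxx].
  split=> [f g [hf pf] [hg pg]|r f hr [hf pf]].
    by split; [exact: ring_atD|exact: vposD].
  by split; [exact: ring_atM|apply: vposM => //; apply: hr].
split.
  by move=> [_ /(_ (oner_neq0 _))]; rewrite (valu1 (place_valuation n b)).
move=> f g hf hg [_ fg].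
have [f0|f0] := eqVneq f 0; first by left; split; rewrite // f0 /vpos eqxx.
have [g0|g0] := eqVneq g 0; first by right; split; rewrite // g0 /vpos eqxx.
have := fg (mulf_neq0 f0 g0); rewrite (valuM (place_valuation n b)) //.
have [pf|pf] := ltP 0 (place n b f); first by left; split.
by move=> h; right; split=> // _; move: h pf; clear; lia.
Qed.

(** The element is [(X - c)^e (X - c')^e / p], with [c'] the other center: its second factor removes
    the pole of [1 / p] at the other place over p, so the element lies in the ring. *)
Lemma place_residue n b : active n b -> exists f i,
  [/\ ring_at f, min_term (P n) (ram n) (shift (C n b) f) 0 i & (0 < i)%N].
Proof.
move=> hnb.
have P0 : ((P n)%:Z)%:~R != 0 :> rat.
  by rewrite intr_eq0; have := prime_gt0 (P_pr n); lia.
pose g := (((P n)%:Z)%:~R^-1)%:P * center n b ^+ (ram n).-1 * center n (~~ b) ^+ ram n.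
(* One factor [center n b], of residue index 1, is split off: it makes the index of [f] positive
   whatever the index of [g]. *)
pose f := g * center n b.
have aP0 : (((P n)%:Z)%:~R^-1)%:P != 0 :> {poly rat} by rewrite polyC_eq0 invr_eq0.
have c0 c i : center n c ^+ i != 0 by rewrite expf_neq0 // center_neq0.
have g0 : g != 0 by rewrite !mulf_neq0.
have f0 : f != 0 by rewrite mulf_neq0 ?center_neq0.
have fE m c : place m c f = - (ram m)%:Z * (m == n)%:Z +
    place m c (center n b) * (ram n)%:Z + place m c (center n (~~ b)) * (ram n)%:Z.
  have vm := place_valuation m c.
  rewrite (valuM vm) ?center_neq0 // (valuM vm) ?mulf_neq0 // (valuM vm) //.
  rewrite placeC ?invr_eq0 // !(valuX vm) ?center_neq0 //.
  rewrite (valuV (vp_valuation (P_pr m))) // vp_P.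
  have := ram_gt0 n; case: (ram n) => // k _ /=.
  by rewrite -[k.+1]addn1 PoszD; ring.
have fn c : place n c f = 0.
  rewrite fE eqxx mulr1; have [->|ne] := eqVneq c b.
    by rewrite place_center place_other_center; ring.
  have cE : c = ~~ b by case: (c) (b) ne => [] [].
  have bE : b = ~~ c by rewrite cE negbK.
  by rewrite -cE {1}bE place_other_center place_center; ring.
have [k mg] := gauss_exists (ram n) (C n b) (P_pr n) g0.
have mf := min_termM (P_pr n) mg (min_term_center (ram n) (C n b) (P_pr n)).
rewrite -comp_polyM in mf.
exists f, (k + 1)%N; split; last by rewrite addn1.
  move=> m c _; have [->|mn] := eqVneq m n; first by rewrite fn.
  by rewrite fE (negbTE mn) mulr0 add0r addr_ge0 // mulr_ge0 // place_center_ge0.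
suff <- : gauss (P n) (ram n) (C n b) g + 1 = 0 by [].
rewrite -(fn b) (valuM (place_valuation n b)) ?center_neq0 //.
by rewrite place_center.
Qed.

Lemma place_ideal_not_maximal n b Q : active n b ->
  (forall f, Q f <-> place_ideal n b f) -> ~ maximal_ideal ring_at Q.
Proof.
move=> hnb QE [_ [_ hmax]].
have [f [i [hf mf i0]]] := place_residue hnb.
have [[_ [P0 [PD PM]]] _] := place_ideal_prime hnb.
(* [I] is generated by the place ideal and [f]. Maximality would make [f] invertible modulo the
   place ideal or put it inside, but its residue has positive degree. *)
pose I g := ring_at g /\ exists r, ring_at r /\ place_ideal n b (g - r * f).
have hI : ideal ring_at I.
  split; first by move=> g [].
  split; first by split; [exact: ring_at0|exists 0; rewrite mul0r subr0; split; [exact: ring_at0|]].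
  split.
    move=> g g' [hg [r [hr gr]]] [hg' [r' [hr' gr']]]; split; first exact: ring_atD.
    exists (r + r'); split; first exact: ring_atD.
    have -> : g + g' - (r + r') * f = (g - r * f) + (g' - r' * f) by ring.
    exact: PD.
  move=> s g hs [hg [r [hr gr]]]; split; first exact: ring_atM.
  exists (s * r); split; first exact: ring_atM.
  have -> : s * g - s * r * f = s * (g - r * f) by ring.
  exact: PM.
have [|[_ [r [hr [_ pr]]]]|h] := hmax I hI.
- move=> g /QE [hg pg]; split=> //; exists 0; split; first exact: ring_at0.
  by rewrite mul0r subr0; split.
- by apply: (residue_not_unit (P_pr n) mf i0 _ pr) => r0; apply: hr.
have /QE [_ pf] : Q f.
  apply: h; split=> //; exists 1; split; first exact: ring_at1.
  by rewrite mul1r subrr.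
have f0 : f != 0 by case: mf => + _ _ _; apply: contraNneq => ->; rewrite /shift comp_poly0 coef0.
have := pf f0; rewrite /place (gaussP (P_pr n) mf); lia.
Qed.

(** Otherwise choose, at each of the finitely many active places where [m] may fail to be a unit, an
    element of the place ideal outside [Q]. Their product [y] is outside [Q], yet [y ^+ K] is a
    multiple of [m] in the ring once [K] bounds the values of [m]. *)
Lemma prime_ideal_contains_place_ideal Q (m : int) : prime_ideal ring_at Q ->
  m != 0 -> Q m%:~R ->
  exists n b, active n b /\ forall f, place_ideal n b f -> Q f.
Proof.
move=> [[QR [Q0 [QD QM]]] [Q1 Qp]] m0 Qm; apply: contrapT => no.
have mE : (m%:~R : {poly rat}) = (m%:~R : rat)%:P by rewrite rmorph_int.
have mP0 : (m%:~R : {poly rat}) != 0 by rewrite mE polyC_eq0 intr_eq0.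
have /choice [x hx] : forall t : nat * bool, exists f,
    active t.1 t.2 -> place_ideal t.1 t.2 f /\ ~ Q f.
  move=> [n b]; case: (EM (active n b)) => [h|h]; last by exists 0.
  apply: contrapT => no'; apply: no; exists n, b; split=> // f hf.
  by apply: contrapT => nQ; apply: no'; exists f.
have [N hN] := place_finite mP0.
pose T := [seq t <- [seq (n, b) | n <- iota 0 N, b <- [:: true; false]] |
           `[< active t.1 t.2 >]].
have TP t : t \in T -> active t.1 t.2 by rewrite mem_filter => /andP [/asboolP].
have xn0 t : t \in T -> x t != 0.
  by move=> /TP /hx [_ nQ]; apply: contra_notN nQ => /eqP ->.
pose y := \prod_(t <- T) x t.
have yn0 : y != 0 by rewrite /y prodf_seq_neq0; apply/allP => t tT; rewrite xn0.
have Ty S : {subset S <= T} -> ring_at (\prod_(t <- S) x t) /\ ~ Q (\prod_(t <- S) x t).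
  elim: S => [|t S IH] sub; first by rewrite big_nil; split=> //; exact: ring_at1.
  have [|h1 h2] := IH; first by move=> u uS; apply: sub; rewrite inE uS orbT.
  have [[h3 _] h4] := hx t (TP t (sub t (mem_head _ _))).
  rewrite big_cons; split; first exact: ring_atM.
  by move=> /Qp [].
have [Ry nQy] := Ty T (fun t h => h).
have Ryk k : ring_at (y ^+ k) /\ ~ Q (y ^+ k).
  elim: k => [|k [h1 h2]]; first by rewrite expr0; split=> //; exact: ring_at1.
  by rewrite exprS; split; [exact: ring_atM|move=> /Qp []].
pose K := (\max_(t <- T) `|place t.1 t.2 m%:~R|%N)%N.
have [_ []] := Ryk K.
have aP0 : (m%:~R^-1 : rat)%:P != 0 by rewrite polyC_eq0 invr_eq0 intr_eq0.
have am : (m%:~R^-1 : rat)%:P * m%:~R = 1 :> {poly rat}.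
  by rewrite mE -polyCM mulVf ?intr_eq0.
have -> : y ^+ K = (m%:~R^-1 : rat)%:P * y ^+ K * m%:~R by rewrite mulrAC am mul1r.
apply: QM => // n b hnb; have vn := place_valuation n b.
have pa : place n b (m%:~R^-1 : rat)%:P = - place n b m%:~R.
  by have := congr1 (place n b) am; rewrite (valuM vn) // (valu1 vn); lia.
rewrite (valuM vn) ?expf_neq0 // pa (valuX vn) //.
have py : 0 <= place n b y := Ry n b hnb.
have [nN|Nn] := ltnP n N; last by rewrite hN // oppr0 add0r mulr_ge0.
have nT : (n, b) \in T by rewrite mem_filter mem_places // andbT; apply/asboolP.
have le1 : 1 <= place n b y.
  have [_ ->] := @valu_prod _ _ vn _ T xpredT x (fun t tT _ => xn0 t tT).
  rewrite (big_rem _ nT) /= -[1]addr0; apply: lerD.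
    by have [[_ +] _] := hx (n, b) hnb; rewrite -gtz0_ge1; apply; apply: xn0.
  rewrite big_seq; apply: sumr_ge0 => t /mem_rem /TP /hx [[hr _] _]; exact: hr.
have leK : place n b m%:~R <= K%:Z.
  have := @leq_bigmax_seq _ T xpredT (fun t => `|place t.1 t.2 m%:~R|%N) (n, b) nT isT.
  by rewrite /= -/K; move: (place n b _) => p; lia.
have := ler_wpM2r (isT : 0 <= K%:Z) le1; rewrite mul1r => h.
by rewrite addrC subr_ge0 (le_trans leK).
Qed.

Lemma ring_at_pure : pure ring_at.
Proof.
move=> Q [Qp [_ Qh1]] [m [m0 Qm]].
have [n [b [hnb sub]]] := prime_ideal_contains_place_ideal Qp m0 Qm.
apply: (place_ideal_not_maximal hnb) => f; split; last exact: sub.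
case: (Qh1 _ (place_ideal_prime hnb) sub) => [z|]; last by apply.
(* The place ideal contains the integer [P n], so it is not zero and height one leaves only equality
   with [Q]. *)
have Pn0 : (P n)%:Z != 0 by have := prime_gt0 (P_pr n); lia.
have : ((P n)%:Z%:~R : {poly rat}) = 0.
  have pE m' c : place m' c (P n)%:Z%:~R = (ram m')%:Z * (m' == n)%:Z.
    by rewrite place_intC // /= logn_prime // (inj_eq P_inj).
  apply: z; split=> [m' c _|_]; first by rewrite pE.
  by rewrite pE eqxx mulr1 ltz_nat ram_gt0.
by move/eqP; rewrite -[_%:~R](rmorph_int (@polyC _)) polyC_eq0 intr_eq0 (negbTE Pn0).
Qed.

(** * The divisor class group *)

(** The choice depends on the predicate alone, so divisors agreeing at the irreducibles receive the
    same function. *)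
Definition choose_frac (Q : QX -> Prop) : QX :=
  if pselect (exists f, f != 0 /\ Q f) is left h then projT1 (cid h) else 1.

Definition irr_part D : QX :=
  choose_frac (fun f => forall q, monic_irreducible q -> irr_val q f = D (inl q)).

Lemma irr_partP D : finsupp ess D -> irr_part D != 0 /\
  forall q, monic_irreducible q -> irr_val q (irr_part D) = D (inl q).
Proof.
move=> fD; rewrite /irr_part /choose_frac; case: pselect => [h|[]]; first by case: cid.
by have [x x0 hx] := irr_part_exists fD; exists x.
Qed.

(* The place [(n, false)] goes to the generator of the [n]-th cyclic summand and
   [(n, true)], which is active only if that summand is infinite, to its opposite;
   [f] is meant to have the same irreducible part as [D]. *)
Definition residual D f (n : nat) : int :=
  if pselect (U n) then
    D (inr (n, false)) - ess_val (inr (n, false)) f -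
    (if o n == 0%N then D (inr (n, true)) - ess_val (inr (n, true)) f else 0)
  else 0.

Lemma residualE D f n : U n -> residual D f n =
  D (inr (n, false)) - ess_val (inr (n, false)) f -
  (if o n == 0%N then D (inr (n, true)) - ess_val (inr (n, true)) f else 0).
Proof. by rewrite /residual; case: pselect. Qed.

Lemma residual0 D f n : ~ U n -> residual D f n = 0.
Proof. by rewrite /residual; case: pselect. Qed.

Definition Usupp (z : nat -> int) : Prop :=
  (exists s : seq nat, forall n, n \notin s -> z n = 0) /\ (forall n, ~ U n -> z n = 0).

Lemma residual_Usupp D f : finsupp ess D -> f != 0 -> Usupp (residual D f).
Proof.
move=> fD f0; split; last by move=> n; apply: residual0.
have [s hs] := finsuppD fD (finsuppN (ess_support f0)).
exists (place_indices s) => n ns.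
case: (EM (U n)) => [Un|]; last exact: residual0.
rewrite residualE //.
have z b : active n b -> D (inr (n, b)) - ess_val (inr (n, b)) f = 0.
  move=> h; apply/eqP; apply: contraNT ns => nz.
  exact: mem_place_indices (hs (inr (n, b)) h nz).
rewrite z ?sub0r; last by split.
by case: eqP => o0; rewrite ?z ?oppr0.
Qed.

Lemma UsuppD z z' : Usupp z -> Usupp z' -> Usupp (fun n => z n + z' n).
Proof.
move=> [[s hs] h] [[s' hs'] h']; split.
  by exists (s ++ s') => n; rewrite mem_cat negb_or => /andP [/hs -> /hs' ->].
by move=> n nU; rewrite h // h'.
Qed.

Lemma UsuppN z : Usupp z -> Usupp (fun n => - z n).
Proof.
move=> [[s hs] h]; split; first by exists s => n /hs ->; rewrite oppr0.
by move=> n nU; rewrite h // oppr0.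
Qed.

Lemma ess_val_C n b (a : rat) : a != 0 ->
  ess_val (inr (n, b)) a%:P%:F = (ram n)%:Z * vp (P n) a.
Proof. by move=> a0; rewrite ess_val_place ?polyC_eq0 // placeC. Qed.

(* Two choices of [f] differ by a constant [a], whose divisor is a combination
   of the divisors of the primes [P n]. *)
Lemma residual_indep D f g : f != 0 -> g != 0 ->
  (forall q, monic_irreducible q -> irr_val q f = irr_val q g) ->
  forall n, U n -> exists k, residual D f n - residual D g n = k * (o n)%:Z.
Proof.
move=> f0 g0 fg n Un.
have fg0 : f / g != 0 := mulf_neq0 f0 (invr_neq0 g0).
have [q hq|a a0 aE] := irr_val_const fg0.
  by rewrite (valu_div (irr_val_valuation hq.2) f0 g0) fg // subrr.
have aF : a%:P%:F != 0 :> QX by rewrite tofrac_eq0 polyC_eq0.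
have fE : f = a%:P%:F * g by rewrite -aE (divfK g0).
have vE b : active n b -> ess_val (inr (n, b)) f =
    (ram n)%:Z * vp (P n) a + ess_val (inr (n, b)) g.
  move=> h; rewrite fE (valuM (ess_valuation (h : ess (inr (n, b)))) aF g0).
  by rewrite ess_val_C.
rewrite !residualE // vE /ram; last by split.
(* For infinite order the constant shifts both places equally and cancels in the difference; for
   finite order the shift is a multiple of [ram n = o n]. *)
case: eqP => [o0|_].
  by exists 0; rewrite vE /ram ?o0 //=; ring.
by exists (- vp (P n) a); ring.
Qed.

Variables (H : Type) (Hin : H -> Prop) (add : H -> H -> H) (zero : H).
Variable gamma : (nat -> int) -> H.
Hypothesis gamma_in : forall z, Usupp z -> Hin (gamma z).
Hypothesis gammaD : forall z z', Usupp z -> Usupp z' ->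
  gamma (fun n => z n + z' n) = add (gamma z) (gamma z').
Hypothesis gamma_eq0 : forall z, Usupp z ->
  (gamma z = zero <-> forall n, U n -> exists k, z n = k * (o n)%:Z).
Hypothesis gamma_onto : forall h, Hin h -> exists2 z, Usupp z & gamma z = h.
Hypothesis addr_zero : forall h, add h zero = h.

Definition class_of D : H := gamma (residual D (irr_part D)).

Lemma class_ofE D f : finsupp ess D -> f != 0 ->
  (forall q, monic_irreducible q -> irr_val q f = D (inl q)) ->
  class_of D = gamma (residual D f).
Proof.
move=> fD f0 hf; have [g0 hg] := irr_partP fD; rewrite /class_of.
set g := irr_part D in g0 hg *.
have sf := residual_Usupp fD f0; have sg := residual_Usupp fD g0.
have sd := UsuppD sg (UsuppN sf).
have /gamma_eq0 : Usupp (fun n => residual D g n - residual D f n) := sd.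
move=> [_] /(_ _) E.
have {}E : gamma (fun n => residual D g n - residual D f n) = zero.
  by apply: E; apply: residual_indep => // q hq; rewrite hf // hg.
rewrite -[RHS]addr_zero -E -gammaD //; congr gamma; apply/funext => n.
by rewrite addrC subrK.
Qed.

Lemma class_group : cl_iso ring_at Hin add zero.
Proof.
have ex : exists j, ess j.
  exists (inl 'X); split; first exact: monicX.
  by rewrite -['X]subr0 -polyC0; apply: irredp_XsubC.
apply: (class_group_iso (cls := class_of) ess_valuation inK_ring_at ess_support ex
  ess_approx).
- move=> D D' DE; rewrite /class_of.
  have -> : irr_part D = irr_part D'.
    rewrite /irr_part; congr choose_frac; apply/funext => f; apply/propext.
    by split=> h q hq; rewrite h // DE.
  congr gamma; apply/funext => n.
  case: (EM (U n)) => [Un|nU]; last by rewrite !residual0 ?addr0.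
  rewrite !residualE //.
  rewrite DE; last by split.
  by case: eqP => // o0; rewrite DE.
- move=> D fD; apply/gamma_in/residual_Usupp => //.
  by have [] := irr_partP fD.
- move=> D D' fD fD'; have [f0 hf] := irr_partP fD; have [g0 hg] := irr_partP fD'.
  have fg0 : irr_part D * irr_part D' != 0 := mulf_neq0 f0 g0.
  have hfg q : monic_irreducible q ->
      irr_val q (irr_part D * irr_part D') = D (inl q) + D' (inl q).
    by move=> hq; rewrite (valuM (irr_val_valuation hq.2) f0 g0) hf // hg.
  rewrite (class_ofE (finsuppD fD fD') fg0 hfg) /class_of.
  rewrite -(gammaD (residual_Usupp fD f0) (residual_Usupp fD' g0)).
  congr gamma; apply/funext => n.
  case: (EM (U n)) => [Un|nU]; last by rewrite !residual0 ?addr0.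
  have vM b : active n b -> ess_val (inr (n, b)) (irr_part D * irr_part D') =
      ess_val (inr (n, b)) (irr_part D) + ess_val (inr (n, b)) (irr_part D').
    by move=> h; apply: (valuM (ess_valuation (h : ess (inr (n, b)))) f0 g0).
  rewrite !residualE // vM; last by split.
  by case: eqP => o0; rewrite ?vM //; ring.
- move=> D fD; split; last first.
    move=> [x [x0 hx]].
    rewrite (@class_ofE _ x) //; last by move=> q hq; rewrite (hx (inl q) hq).
    apply/gamma_eq0; first exact: residual_Usupp.
    move=> n Un; exists 0; rewrite mul0r residualE //.
    rewrite hx ?subrr; last by split.
    by case: eqP => o0; rewrite ?hx ?subrr ?oppr0.
  have [f0 hf] := irr_partP fD; set f := irr_part D in f0 hf.
  have sf := residual_Usupp fD f0.
  rewrite /class_of gamma_eq0 // -/f => hz.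
  pose E j := D j - ess_val j f.
  have [s hs] : finsupp ess E := finsuppD fD (finsuppN (ess_support f0)).
  (* A residual divisible by the order makes [E] look like the divisor of a power of [P n]: two
     places of ramification 1 carry equal values, or a single place carries a multiple of its
     ramification. *)
  have hm n : exists m, forall b, active n b -> E (inr (n, b)) = (ram n)%:Z * m.
    case: (EM (U n)) => [Un|nU]; last by exists 0 => b [].
    have [k] := hz n Un; rewrite residualE // /ram.
    rewrite -!/(E _); case: eqP => o0 kE.
      exists (E (inr (n, false))) => b _; rewrite mul1r; case: b => //.
      by move: kE; rewrite o0 mulr0 => /eqP; rewrite subr_eq0 => /eqP.
    exists k => -[] [_ h]; first by case: o0; apply: h.
    by move: kE; rewrite subr0 mulrC.
  have [m {}hm] := choice hm.
  (* [m n] is arbitrary when no place over [P n] is active, hence the cut to the finite support of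
     [E]. *)
  have [|a a0 ha] := @vp_exists (place_indices s)
      (fun n => if n \in place_indices s then m n else 0).
    by move=> n /negbTE ->.
  have aF : a%:P%:F != 0 :> QX by rewrite tofrac_eq0 polyC_eq0.
  exists (a%:P%:F * f); split; first exact: mulf_neq0 aF f0.
  move=> j hj; rewrite (valuM (ess_valuation hj) aF f0).
  case: j hj => [q|[n b]] hj.
    rewrite [X in X + _](_ : _ = 0) ?add0r; first by rewrite /= hf.
    by rewrite ess_val_irr ?polyC_eq0 // qvalC //; case: hj.
  rewrite ess_val_C // ha; apply/eqP; rewrite -subr_eq -/(E _); apply/eqP.
  case: ifP => [_|/negbT ns]; first exact: hm.
  rewrite mulr0; apply/eqP; apply: contraNT ns => nz.
  exact: mem_place_indices (hs (inr (n, b)) hj nz).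
- move=> h /gamma_onto [z [[s hs] zU] <-].
  pose D (j : J) : int := if j is inr (n, false) then z n else 0.
  have fD : finsupp ess D.
    exists [seq inr (n, false) | n <- s] => -[q|[n []]] _; rewrite /D ?eqxx //.
    move=> nz; apply: map_f; apply: contraNT nz => ns; by rewrite hs.
  exists D => //.
  have v1 j : ess j -> ess_val j 1 = 0 by move=> /ess_valuation /valu1.
  rewrite (@class_ofE _ 1) ?oner_neq0 //; last by move=> q hq; exact: (v1 (inl q) hq).
  congr gamma; apply/funext => n; case: (EM (U n)) => [Un|nU]; last by rewrite residual0 // zU.
  rewrite residualE //.
  rewrite v1; last by split.
  by case: eqP => o0; rewrite ?v1 // !subr0.
Qed.

End Family.

(** * Finitely generated abelian groups *)

Lemma int_ideal_principal (I : int -> Prop) : I 0 ->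
  (forall a b, I a -> I b -> I (a - b)) ->
  exists d, I d /\ forall a, I a -> exists q, a = q * d.
Proof.
move=> I0 IB.
have IN a : I a -> I (- a) by move=> h; rewrite -sub0r; apply: IB.
have ID a b : I a -> I b -> I (a + b) by move=> h /IN h'; rewrite -[b]opprK; apply: IB.
have IM (q a : int) : I a -> I (q * a).
  move=> Ia; have In (n : nat) : I (n%:Z * a).
    by elim: n => [|n IH]; rewrite ?mul0r // -[n.+1]add1n PoszD mulrDl mul1r; apply: ID.
  by case: q => n //; rewrite NegzE mulNr; apply/IN/In.
case: (EM (exists a, I a /\ a != 0)) => [[a [Ia a0]]|no]; last first.
  exists 0; split=> // a Ia; exists 0; rewrite mulr0; apply/eqP.
  by apply: contrapT => /negP a0; apply: no; exists a.
have exP : exists n : nat, (0 < n)%N && `[< I n%:Z >].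
  exists `|a|%N; rewrite absz_gt0 a0; apply/asboolP.
  by rewrite abszE; case: ger0P => _ //; apply: IN.
have [d /andP [d0 /asboolP Id] dmin] := ex_minnP exP.
exists d%:Z; split=> // b Ib; exists (b %/ d)%Z.
have E := divz_eq b d.
have dz : d%:Z != 0 by lia.
have Ir : I (b %% d)%Z by rewrite /modz; apply: IB => //; apply: IM.
have r0 := modz_ge0 b dz; have := ltz_mod b dz.
case er : (b %% d)%Z r0 Ir E => [r|r] // _ Ir E lt.
case: r er Ir E lt => [|r] er Ir E lt; first by rewrite {1}E addr0.
have := dmin r.+1; rewrite /= => /(_ _) h; suff : (d <= r.+1)%N by lia.
by apply: h; apply/asboolP.
Qed.

(** Induction on [n]: the first coordinates form an ideal generated by some [d], lifted to a vector
    of [K], and the vectors with first coordinate 0 fall under the induction hypothesis. One row per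
    coordinate gives a square triangular matrix. *)
Lemma int_submodule_mx n (K : 'rV[int]_n -> Prop) : K 0 ->
  (forall x y, K x -> K y -> K (x - y)) ->
  exists H : 'M[int]_n, forall x, K x <-> exists u : 'rV_n, x = u *m H.
Proof.
elim: n K => [|n IH]; last rewrite -[n.+1]/(1 + n)%N; move=> K K0 KB.
  by exists 0 => x; rewrite thinmx0; split=> // _; exists 0; rewrite thinmx0.
have KN x : K x -> K (- x) by move=> h; rewrite -sub0r; apply: KB.
have KD x y : K x -> K y -> K (x + y) by move=> h /KN h'; rewrite -[y]opprK; apply: KB.
have KZ (q : int) x : K x -> K (q *: x).
  move=> Kx; have Kn (k : nat) : K (k%:Z *: x).
    by elim: k => [|k IHk]; rewrite ?scale0r // -[k.+1]add1n PoszD scalerDl scale1r; apply: KD.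
  by case: q => k //; rewrite NegzE scaleNr; apply/KN/Kn.
have [|a b [l hl] [l' hl']|d [[l Kl] hd]] := @int_ideal_principal
    (fun a => exists l : 'rV_n, K (row_mx (a%:M : 'M_1) l)).
- by exists 0; rewrite raddf0 row_mx0.
- exists (l - l'); rewrite raddfB /= -[l - l']/(l + - l') -add_row_mx -opp_row_mx.
  exact: KB.
have [||H' hH'] := IH (fun y => K (row_mx (0 : 'M_1) y)).
- by rewrite row_mx0.
- by move=> x y hx hy; have := KB _ _ hx hy; rewrite opp_row_mx add_row_mx subr0.
exists (block_mx (d%:M : 'M_1) l 0 H') => x; split.
  move=> Kx; pose a := lsubmx x 0 0.
  have xE : x = row_mx (a%:M : 'M_1) (rsubmx x).
    by rewrite -mx11_scalar hsubmxK.
  have [|q aE] := hd a; first by exists (rsubmx x); rewrite -xE.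
  have /hH' [u uE] : K (row_mx 0 (rsubmx x - q *: l)).
    have := KB _ _ Kx (KZ q _ Kl); rewrite {1}xE scale_row_mx opp_row_mx add_row_mx.
    by rewrite aE scale_scalar_mx subrr.
  exists (row_mx (q%:M : 'M_1) u); rewrite mul_row_block mulmx0 addr0 -uE.
  by rewrite -scalar_mxM mul_scalar_mx addrC subrK -aE.
move=> [u ->]; rewrite -[u]hsubmxK.
rewrite mul_row_block mulmx0 addr0 [lsubmx u]mx11_scalar -scalar_mxM mul_scalar_mx.
set q := lsubmx u 0 0.
have -> : row_mx (q * d)%:M (q *: l + rsubmx u *m H') =
    q *: row_mx (d%:M : 'M_1) l + row_mx 0 (rsubmx u *m H').
  by rewrite scale_row_mx add_row_mx addr0 scale_scalar_mx.
by apply: KD; [exact: KZ|apply/hH'; exists (rsubmx u)].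
Qed.

(* Smith normal form of the relation module yields independent generators. *)
Lemma fin_gen_cyclic_sum (M : zmodType) : fin_gen M ->
  exists x : nat * (nat -> M) * (nat -> nat),
  (forall g, exists c : nat -> int, g = \sum_(k < x.1.1) x.1.2 k *~ c k) /\
  (forall c : nat -> int, \sum_(k < x.1.1) x.1.2 k *~ c k = 0 <->
     forall k, (k < x.1.1)%N -> exists u, c k = u * (x.2 k)%:Z).
Proof.
move=> [s hs]; set n := size s in hs.
pose phi (c : 'rV[int]_n) : M := \sum_(k < n) s`_k *~ c 0 k.
have phiB : zmod_morphism phi.
  move=> x y; rewrite /phi -sumrB; apply: eq_bigr => k _.
  by rewrite !mxE mulrzBr.
have phiZ (q : int) x : phi (q *: x) = phi x *~ q.
  rewrite /phi mulrz_suml; apply: eq_bigr => k _.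
  by rewrite mxE -mulrzA mulrC.
have phi0 : phi 0 = 0 by have := phiB 0 0; rewrite !subrr.
have phiD x y : phi (x + y) = phi x + phi y.
  by rewrite -{1}[y]opprK phiB -[- y]sub0r phiB phi0 sub0r opprK.
have [|x y hx hy|H hH] := @int_submodule_mx n (fun c => phi c = 0) => //.
  by rewrite phiB hx hy subrr.
have [L Lu [R Ru [d _ HE]]] := int_Smith_normal_form H.
(* The rows of the invertible [R] give the new generators; as [L] is invertible too, the relations
   are spanned by the diagonal multiples of these rows. *)
pose r (k : nat) : 'rV[int]_n := if insub k is Some i then row i R else 0.
have rE (k : 'I_n) : r k = row k R by rewrite /r valK.
have sE (c : nat -> int) :
    \sum_(k < n) phi (r k) *~ c k = phi ((\row_(k < n) c k) *m R).
  rewrite mulmx_sum_row.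
  rewrite (big_morph phi phiD phi0); apply: eq_bigr => k _.
  by rewrite rE phiZ mxE.
(* Diagonal entries may be negative, hence [absz]. A zero entry, including the default past the end
   of [d], encodes an infinite summand. *)
exists (n, fun k => phi (r k), fun k => absz d`_k); split => /= [g|c].
  have [c gE] := hs g.
  pose v : 'rV[int]_n := \row_(k < n) c`_k.
  pose w := v *m invmx R.
  pose cw (k : nat) : int := if insub k is Some i then w 0 i else 0.
  exists cw; rewrite (sE cw).
  have -> : \row_(k < n) cw k = w by apply/rowP => k; rewrite mxE /cw valK.
  rewrite /w mulmxKV // gE /phi; apply: eq_bigr => k _.
  by rewrite mxE.
rewrite (sE c) hH; split.
  move=> [u]; rewrite HE !mulmxA => /(can_inj (mulmxK Ru)) E k kn.
  have /rowP /(_ (Ordinal kn)) := E; rewrite !mxE (bigD1 (Ordinal kn)) //= big1.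
    rewrite addr0 mxE eqxx mulr1n => ->.
    exists ((u *m L) 0 (Ordinal kn) * sgz d`_k).
    by rewrite -mulrA -intEsg !mxE.
  by move=> i ni; rewrite mxE (negbTE ni : (i == k :> nat) = false) mulr0n mulr0.
move=> hc.
have /choice [u hu] : forall k : 'I_n, exists v, c k = v * d`_k.
  move=> k; have [v ->] := hc k (ltn_ord k).
  by exists (v * sgz d`_k); rewrite -mulrA -abszEsg.
exists ((\row_k u k) *m invmx L).
rewrite HE !mulmxA mulmxKV //; congr (_ *m R).
apply/rowP => k; rewrite !mxE hu (bigD1 k) //= big1 ?addr0.
  by rewrite !mxE eqxx mulr1n.
by move=> i ni; rewrite !mxE (negbTE ni : (i == k :> nat) = false) mulr0n mulr0.
Qed.

(** * Realizing the groups and localizing *)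

Section Realization.
Variables (I : countType) (G : I -> zmodType).
Hypothesis G_fg : forall i, fin_gen (G i).
Variables (P : nat -> nat) (C : nat -> bool -> int).
Hypothesis P_pr : forall n, prime (P n).
Hypothesis P_inj : injective P.
Hypothesis C_sep : forall n, C n true - C n false != 0 /\
  logn (P n) `|C n true - C n false| = 0%N.
Hypothesis C_fin : forall q : {poly int}, q != 0 -> exists N, forall n b, (N <= n)%N ->
  q.[C n b] != 0 /\ logn (P n) `|q.[C n b]| = 0%N.

Definition prime_to (U : nat -> Prop) (s : int) : Prop :=
  s != 0 /\ forall n, U n -> logn (P n) `|s| = 0%N.

Lemma prime_to_mult U : mult_subset (prime_to U).
Proof.
split; first by split=> // n _; rewrite /= logn1.
split; first by move=> [].
move=> a b [a0 ha] [b0 hb]; split; first by rewrite mulf_neq0.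
by move=> n Un; rewrite abszM lognM ?absz_gt0 // ha // hb.
Qed.

Lemma logn_exists (V : pred nat) (K N : nat) : exists2 s : nat, (0 < s)%N &
  forall n, logn (P n) s = if (n < N)%N && V n then K else 0%N.
Proof.
elim: N => [|N [s s0 hs]]; first by exists 1%N => // n; rewrite logn1.
have Pk : (0 < P N ^ K)%N by rewrite expn_gt0 prime_gt0.
exists (if V N then s * P N ^ K else s)%N => [|n]; first by case: ifP; rewrite ?muln_gt0 ?s0.
rewrite (fun_if (logn (P n))) lognM // lognX (logn_prime _ (P_pr N)) (inj_eq P_inj) hs.
have -> : (n < N.+1)%N = (n == N) || (n < N)%N by rewrite ltnS leq_eqVlt.
have [->|nN] := eqVneq n N; last by rewrite /= muln0 addn0 if_same.
by rewrite /= ltnn muln1.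
Qed.

(** A polynomial has negative value at only finitely many places. Those over primes outside [U] are
    cleared by a product of these primes raised to a common power [K], since each has value at least
    1 at its own places. *)
Lemma localize_ring_at o U : localize (ring_at P C o (fun=> True)) (prime_to U) =
  ring_at P C o U.
Proof.
apply/funext => f; apply/propext; split.
- move=> [s [[s0 hs] hf]] n b [Un hb].
  have := hf n b (conj Logic.I hb).
  have [->|f0] := eqVneq f 0; first by rewrite mulr0.
  have sE : (s%:~R : {poly rat}) = (s%:~R : rat)%:P by rewrite rmorph_int.
  rewrite (valuM (place_valuation C o P_pr n b)) //; last by rewrite sE polyC_eq0 intr_eq0.
  by rewrite place_intC // hs // mulr0 add0r.
- move=> hf; have [->|f0] := eqVneq f 0.
    by exists 1; split; [case: (prime_to_mult U)|rewrite mulr0 => n b _; rewrite place0].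
  have [N hN] := place_finite o P_pr C_fin f0.
  pose K := (\max_(n < N) maxn (absz (place P C o n true f)) (absz (place P C o n false f)))%N.
  have [s s0 hs] := logn_exists (fun n => ~~ `[< U n >]) K N.
  have sz : s%:Z != 0 by lia.
  exists s%:Z; split.
    split=> // n Un; rewrite /= hs (_ : `[< U n >]) ?andbF //.
    by apply/asboolP.
  move=> n b [_ hb].
  have sE : (s%:Z%:~R : {poly rat}) = (s%:Z%:~R : rat)%:P by rewrite rmorph_int.
  rewrite (valuM (place_valuation C o P_pr n b)) //; last by rewrite sE polyC_eq0 intr_eq0.
  rewrite place_intC //= hs.
  case: (EM (U n)) => [Un|nU]; first by apply: addr_ge0 => //; apply: hf.
  have [nN|Nn] := ltnP n N; last by rewrite hN // addr0 mulr_ge0.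
  rewrite (_ : ~~ `[< U n >]); last by apply/negP => /asboolP.
  have := leq_bigmax (Ordinal nN) (F := fun n : 'I_N =>
    maxn (absz (place P C o n true f)) (absz (place P C o n false f))).
  rewrite -/K /= geq_max => /andP [h1 h2].
  have hK : (absz (place P C o n b f) <= K)%N by case: (b).
  have := ram_gt0 o n; move: (place _ _ _ _ _ _) (ram _ _) hK => p r hK r0.
  by have := leq_pmull K r0; lia.
Qed.

Let dec i := cid (fin_gen_cyclic_sum (@G_fg i)).
Definition rk i : nat := (projT1 (dec i)).1.1.
Definition gen i : nat -> G i := (projT1 (dec i)).1.2.
Definition ord i : nat -> nat := (projT1 (dec i)).2.

Lemma gen_span i g : exists c : nat -> int, g = \sum_(k < rk i) gen i k *~ c k.
Proof. by have [h _] := projT2 (dec i); exact: h. Qed.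

Lemma gen_rel i (c : nat -> int) : \sum_(k < rk i) gen i k *~ c k = 0 <->
  forall k, (k < rk i)%N -> exists u, c k = u * (ord i k)%:Z.
Proof. by have [_ h] := projT2 (dec i); exact: h. Qed.

Definition owner (n : nat) : option (I * nat) := pickle_inv n.

Lemma owner_pickle x : owner (pickle x) = Some x.
Proof. exact: pickleK_inv. Qed.

Lemma ownerK n : oapp pickle n (owner n) = n.
Proof. exact: pickle_invK. Qed.

(* The [k]-th cyclic summand of [G i] is carried by the prime of index
   [pickle (i, k)]; at all other primes the class group is made trivial. *)
Definition order_at (n : nat) : nat :=
  if owner n is Some (i, k)
  then (if (k < rk i)%N then ord i k else 1%N) else 1%N.

Definition block (i : I) (n : nat) : Prop := exists k : nat, n = pickle (i, k).

Definition sum_at i (z : nat -> int) : G i :=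
  \sum_(k < rk i) gen i k *~ z (pickle (i, nat_of_ord k)).

Lemma order_at_pickle (i : I) (k : nat) :
  order_at (pickle (i, k)) = if (k < rk i)%N then ord i k else 1%N.
Proof. by rewrite /order_at owner_pickle. Qed.

Lemma sum_atD i z z' : sum_at i (fun n => z n + z' n) = sum_at i z + sum_at i z'.
Proof. by rewrite -big_split; apply: eq_bigr => k _; rewrite mulrzDr. Qed.

Lemma sum_at_eq0 i z : sum_at i z = 0 <->
  forall n, block i n -> exists u, z n = u * (order_at n)%:Z.
Proof.
rewrite (gen_rel i (fun k => z (pickle (i, k)))); split.
  move=> h _ [k ->]; rewrite order_at_pickle; case: ifP => [/h //|_].
  by exists (z (pickle (i, k))); rewrite mulr1.
by move=> h k kr; have [|u ->] := h (pickle (i, k)); [exists k|exists u; rewrite order_at_pickle kr].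
Qed.

Lemma block_unpickle n : ~ (exists i, block i n) -> order_at n = 1%N.
Proof.
rewrite /order_at; case E : owner => [[i k]|] // []; exists i, k.
by have := ownerK n; rewrite E.
Qed.

Lemma class_group_block i :
  cl_iso (ring_at P C order_at (block i)) (fun _ : G i => True) (fun a b => a + b) 0.
Proof.
apply: (class_group P_pr P_inj C_sep C_fin (gamma := sum_at i)) => //.
- by move=> z z' _ _; apply: sum_atD.
- by move=> z _; apply: sum_at_eq0.
- move=> g _; have [c gE] := gen_span g.
  pose z n : int := if owner n is Some (j, k)
    then (if (j == i) && (k < rk i)%N then c k else 0) else 0.
  exists z.
    split.
      exists [seq pickle (i, k) | k <- iota 0 (rk i)] => n; rewrite /z.
      have := ownerK n.
      case: owner => [[j k]|] //= <- nm; case: ifP => // /andP [/eqP ji kr].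
      by case/negP: nm; rewrite ji; apply: map_f; rewrite mem_iota.
    move=> n nb; rewrite /z; have := ownerK n.
    case: owner => [[j k]|] //= E; case: ifP => // /andP [/eqP ji _].
    by case: nb; exists k; rewrite -E ji.
  rewrite gE; apply: eq_bigr => k _.
  by rewrite /z owner_pickle eqxx ltn_ord.
- by move=> h; rewrite addr0.
Qed.

Lemma class_group_sum : cl_iso (ring_at P C order_at (fun=> True))
  (@dsum_in I G) (@dsum_add I G) (@dsum_zero I G).
Proof.
apply: (class_group P_pr P_inj C_sep C_fin (gamma := fun z i => sum_at i z)).
- move=> z [[s hs] _].
  exists (pmap (fun n => omap fst (owner n)) s) => i ni.
  apply: big1 => k _; rewrite hs ?mulr0z //; apply: contra ni => h.
  by rewrite mem_pmap; apply/mapP; exists (pickle (i, nat_of_ord k)); rewrite ?owner_pickle.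
- by move=> z z' _ _; apply: functional_extensionality_dep => i; apply: sum_atD.
- move=> z _; split=> [h n _|h].
    (* An index carrying no summand has order 1, of which every integer is a multiple. *)
    case: (EM (exists i, block i n)) => [[i hb]|/block_unpickle ->]; last first.
      by exists (z n); rewrite mulr1.
    by apply: (sum_at_eq0 i z).1 hb; exact: (congr1 (fun f => f i) h).
  apply: functional_extensionality_dep => i; apply/sum_at_eq0 => n _; exact: h.
- move=> h [s hs].
  have cE i : exists c : nat -> int, h i = \sum_(k < rk i) gen i k *~ c k := gen_span (h i).
  have [c {}cE] := choice cE.
  pose z n : int := if owner n is Some (j, k)
    then (if (j \in s) && (k < rk j)%N then c j k else 0) else 0.
  exists z.
    split=> //; exists [seq pickle (i, k) | i <- s, k <- iota 0 (rk i)] => n; rewrite /z.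
    have := ownerK n.
    case: owner => [[j k]|] //= <- nm; case: ifP => // /andP [js kr].
    case/negP: nm; apply/allpairsPdep; exists j, k; split=> //.
    by rewrite mem_iota.
  apply: functional_extensionality_dep => i; have [si|ni] := boolP (i \in s).
    by rewrite cE; apply: eq_bigr => k _; rewrite /z owner_pickle si ltn_ord.
  rewrite hs //; apply: big1 => k _.
  by rewrite /z owner_pickle (negbTE ni) mulr0z.
- by move=> h; apply: functional_extensionality_dep => i; rewrite /dsum_add addr0.
Qed.

End Realization.

Theorem mainTheorem19 (I : countType) (G : I -> zmodType) :
  (forall i, fin_gen (G i)) ->
  exists R : {poly rat} -> Prop,
    poly_ring_between R /\ krull R /\ pure R /\
    cl_iso R (@dsum_in I G) (@dsum_add I G) (@dsum_zero I G) /\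
    (forall i : I, exists S : int -> Prop,
       mult_subset S /\ krull (localize R S) /\ pure (localize R S) /\
       cl_iso (localize R S) (fun _ : G i => True) (fun a b => a + b) 0).
Proof.
move=> G_fg; have [P [C [P_pr P_inj C_sep C_fin]]] := places_exist.
pose o := order_at G_fg; exists (ring_at P C o (fun=> True)).
split; first exact: ring_at_between.
split; first exact: ring_at_krull.
split; first exact: ring_at_pure.
split; first exact: class_group_sum.
move=> i; exists (prime_to P (block i)); rewrite localize_ring_at //.
split; first exact: prime_to_mult.
split; first exact: ring_at_krull.
split; first exact: ring_at_pure.
exact: class_group_block.
Qed.
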